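(* Let $v\colon[0,1)\to(0,\infty)$ be a log-convex weight function such that: there exist $\alpha>0$ and $r_0\in(0,1)$ for which $v(r)(1-r)^{-\alpha}$ is increasing on $[r_0,1)$; and there exist (possibly different) $\alpha'>0$ and $r_0'\in(0,1)$ for which $v(r)(1-r)^{-\alpha'}$ is decreasing on $[r_0',1)$. Let $w(r):=(1-r)v(r)$ for $r\in[0,1)$, and let $g\in H(\mathbb{D})$ satisfy $g',\frac1{g'}\in H^\infty$. (i) Whenever the operator $V_g\colon H^\infty_v\to H^\infty_v$ is continuous, the optimal domains satisfy $[V_g,H^\infty_v]=[T_g,H^\infty_v]=H^\infty_w$ as linear subspaces of $H(\mathbb{D})$ and with equivalent norms. (ii) Suppose that $\lim_{r\to1^-}v(r)=0$ and the operator $V_g\colon H^0_v\to H^0_v$ is continuous. Then $[V_g,H^0_v]=[T_g,H^0_v]=H^0_w$ as linear subspaces of $H(\mathbb{D})$ and with equivalent norms. (iii) Suppose that $\lim_{r\to1^-}v(r)=0$ and the operator $V_g\colon H^0_v\to H^0_v$ is compact. Then $H^\infty_v$ is a proper subspace of $[V_g,H^0_v]=[T_g,H^0_v]=H^0_w$.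
   Context: $\mathbb{D}=\{z\in\mathbb{C}:|z|<1\}$; $H(\mathbb{D})$ is the Fréchet space of all analytic functions on $\mathbb{D}$ with the topology of uniform convergence on compact sets; $H^\infty$ is the space of bounded analytic functions on $\mathbb{D}$. The condition $\frac1{g'}\in H^\infty$ means that $g'$ has no zeros in $\mathbb{D}$ and $1/g'$ is bounded. For $g\in H(\mathbb{D})$ and $f\in H(\mathbb{D})$, $(V_gf)(z):=\int_0^z f(\xi)g'(\xi)\,d\xi$ for $z\in\mathbb{D}$, and $(T_gf)(z):=\frac1z\int_0^z f(\xi)g'(\xi)\,d\xi$ for $z\in\mathbb{D}\setminus\{0\}$, $(T_gf)(0):=f(0)g'(0)$. A weight is a continuous, non-increasing function $v\colon[0,1)\to(0,\infty)$, extended to $\mathbb{D}$ by $v(z):=v(|z|)$. It is log-convex if $x\mapsto -\log v(e^x)$ is convex on $(-\infty,0)$. Define $H^\infty_v:=\{f\in H(\mathbb{D}):\|f\|_{\infty,v}:=\sup_{z\in\mathbb{D}}|f(z)|v(z)<\infty\}$ and $H^0_v:=\{f\in H(\mathbb{D}):\lim_{|z|\to1^-}|f(z)|v(z)=0\}$, both with norm $\|\cdot\|_{\infty,v}$ (similarly for $w$). For $X$ a Banach space continuously included in $H(\mathbb{D})$ and $T\colon H(\mathbb{D})\to H(\mathbb{D})$ continuous linear with $T(X)\subseteq X$, the optimal domain is $[T,X]:=\{f\in H(\mathbb{D}):Tf\in X\}$ with (semi-)norm $\|f\|_{[T,X]}:=\|Tf\|_X$. Saying that $T\colon X\to X$ is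 continuous (compact) includes that $T(X)\subseteq X$. *)

(* Defs.v *)
From Stdlib Require Import Reals List.
From Coquelicot Require Import Coquelicot.
Open Scope R_scope.

(* A function on the open unit disc D is represented by a total function
   C -> C whose values off D are ignored: all the predicates and norms below
   only look at points of D. *)
Definition in_disc (z : C) : Prop := Cmod z < 1.

(* H(D) *)
Definition analytic (f : C -> C) : Prop :=
  forall z : C, in_disc z -> ex_derive f z.

(* H^oo *)
Definition bounded_analytic (f : C -> C) : Prop :=
  analytic f /\ exists M : R, forall z : C, in_disc z -> Cmod (f z) <= M.

(* Coquelicot's [Cinv] is total, so the absence of zeros is explicit. *)
Definition inv_bounded_analytic (f : C -> C) : Prop :=
  (forall z : C, in_disc z -> f z <> 0%C) /\
  bounded_analytic (fun z => (/ f z)%C).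

(* Integral of f along the straight segment from a to b. *)
Definition Cint_seg (f : C -> C) (a b : C) : C :=
  ((b - a) *
   (RInt (V := C_R_CompleteNormedModule)
      (fun t : R => f (a + RtoC t * (b - a))%C) 0 1))%C.

Definition Vop (g f : C -> C) : C -> C :=
  fun z => Cint_seg (fun xi => (f xi * C_derive g xi)%C) 0%C z.

Definition Top (g f : C -> C) : C -> C :=
  fun z => if Ceq_dec z 0%C then (f 0%C * C_derive g 0%C)%C
           else (/ z * Cint_seg (fun xi => (f xi * C_derive g xi)%C) 0%C z)%C.

(* Weights v : [0,1) -> (0,oo); the values of v off [0,1) are irrelevant. *)
Definition weight (v : R -> R) : Prop :=
  (forall r, 0 <= r < 1 -> 0 < v r) /\
  continuous_on (fun r => 0 <= r < 1) v /\
  (forall r s, 0 <= r -> r <= s -> s < 1 -> v s <= v r).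

Definition log_convex (v : R -> R) : Prop :=
  forall x y t, x < 0 -> y < 0 -> 0 <= t <= 1 ->
    - ln (v (exp (t * x + (1 - t) * y))) <=
      t * (- ln (v (exp x))) + (1 - t) * (- ln (v (exp y))).

Definition increasing_from (r0 : R) (h : R -> R) : Prop :=
  forall r s, r0 <= r -> r <= s -> s < 1 -> h r <= h s.

Definition decreasing_from (r0 : R) (h : R -> R) : Prop :=
  forall r s, r0 <= r -> r <= s -> s < 1 -> h s <= h r.

(* A linear space of functions with a (semi-)norm; the norm is Rbar-valued so
   that finiteness is expressed honestly. *)
Record fspace := FSpace {
  fmem :> (C -> C) -> Prop;
  fnorm : (C -> C) -> Rbar
}.

Definition wnorm (v : R -> R) (f : C -> C) : Rbar :=
  Lub_Rbar (fun y => exists z : C, in_disc z /\ y = Cmod (f z) * v (Cmod z)).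

Definition Hinf (v : R -> R) : fspace :=
  FSpace (fun f => analytic f /\ Rbar_lt (wnorm v f) p_infty) (wnorm v).

Definition Hzero (v : R -> R) : fspace :=
  FSpace
    (fun f => analytic f /\
       forall eps, 0 < eps -> exists rho, 0 <= rho < 1 /\
         forall z : C, rho < Cmod z < 1 -> Cmod (f z) * v (Cmod z) < eps)
    (wnorm v).

(* [T, X] *)
Definition optimal_domain (T : (C -> C) -> C -> C) (X : fspace) : fspace :=
  FSpace (fun f => analytic f /\ X (T f)) (fun f => fnorm X (T f)).

Definition same_space (X Y : fspace) : Prop := forall f, X f <-> Y f.

Definition equivalent_norms (X Y : fspace) : Prop :=
  exists a b : R, 0 < a /\ 0 < b /\
    forall f, X f ->
      Rbar_le (Rbar_mult a (fnorm Y f)) (fnorm X f) /\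
      Rbar_le (fnorm X f) (Rbar_mult b (fnorm Y f)).

Definition same_space_equiv_norms (X Y : fspace) : Prop :=
  same_space X Y /\ equivalent_norms X Y.

Definition proper_subspace (X Y : fspace) : Prop :=
  (forall f, X f -> Y f) /\ exists f, Y f /\ ~ X f.

Definition fsub (f h : C -> C) : C -> C := fun z => (f z - h z)%C.

Definition maps_into (T : (C -> C) -> C -> C) (X : fspace) : Prop :=
  forall f, X f -> X (T f).

Definition continuous_op (T : (C -> C) -> C -> C) (X : fspace) : Prop :=
  maps_into T X /\
  forall f, X f -> forall eps, 0 < eps -> exists delta, 0 < delta /\
    forall h, X h -> Rbar_lt (fnorm X (fsub h f)) delta ->
      Rbar_lt (fnorm X (fsub (T h) (T f))) eps.

(* Topology of X induced by its norm; sets are predicates, of which only the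
   restriction to X matters. *)
Definition open_in (X : fspace) (U : (C -> C) -> Prop) : Prop :=
  forall f, X f -> U f -> exists eps, 0 < eps /\
    forall h, X h -> Rbar_lt (fnorm X (fsub h f)) eps -> U h.

Definition closure_in (X : fspace) (A : (C -> C) -> Prop) : (C -> C) -> Prop :=
  fun f => X f /\ forall eps, 0 < eps ->
    exists h, X h /\ A h /\ Rbar_lt (fnorm X (fsub h f)) eps.

Definition compact_in (X : fspace) (K : (C -> C) -> Prop) : Prop :=
  forall (I : Type) (U : I -> (C -> C) -> Prop),
    (forall i, open_in X (U i)) ->
    (forall f, K f -> exists i, U i f) ->
    exists l : list I, forall f, K f -> exists i, In i l /\ U i f.

(* T X is contained in X and T maps the closed unit ball of X onto a relatively
   compact subset of X. *)
Definition compact_op (T : (C -> C) -> C -> C) (X : fspace) : Prop :=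
  maps_into T X /\
  compact_in X (closure_in X
    (fun k => exists f, X f /\ Rbar_le (fnorm X f) 1 /\ k = T f)).

(* Main.v *)
Require Import Defs.
From Stdlib Require Import Reals List.
From Stdlib Require Import Lra Lia Classical ClassicalEpsilon.
From Coquelicot Require Import Coquelicot.
Open Scope R_scope.

(* Put [h = f g'] and [F = V_g f], so that [F' = h] and, [g'] and [1/g'] being bounded, [f] and
   [h] are interchangeable in every estimate. Since [v r (1-r)^(-alpha')] is eventually
   decreasing, [v r * int_0^r ds / ((1-s) v s)] is bounded, so a bound on [(1-|z|) v |h|] gives
   one on [v |F|] and on [v |F/z|]. Conversely Cauchy's estimate on the disc of radius [(1-|z|)/2]
   about [z], where [v] varies by a bounded factor because [v r (1-r)^(-alpha)] is eventually
   increasing, bounds [(1-|z|) v |h|] by [v |F|]. Both estimates have little-o versions.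
   For (iii), [H^oo_v] lies in [H^0_w] trivially, and the lacunary series
   [sum_k 2^k / v (1-1/N_k) z^(N_k)] with [N_k = 2 * 16^k] separates the two: its value at [1-1/N_k]
   is at least [2^k / (4 v)], while each term times [(1-r) v r] is [O (2^(-k) (1-r)^(1/2))].

   Goursat's theorem is proved by bisection of triangles, as analyticity is mere complex
   differentiability. Cauchy's estimate is deduced from it with a single trapezoid (see
   [four_fold]), avoiding circles and the integral formula. *)

(** * Complex differentiability *)

(** Goursat's theorem is available here on convex sets only, whereas the kernel [1/x^2] of Cauchy's
    formula is singular inside every contour around [0]. The sides of a square centred at [0] are
    rotations of one another by powers of [i], so the contour integral of [F (z + x) / x^2] is the
    integral over one side of the rotated sum [four_fold]. That single side can be moved from a
    small square to a large one through a convex region that avoids [0]. Only a lower bound is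
    needed on the small side, so no value of an integral involving pi enters.

    In the little-o estimate for primitives, the part of the ray inside a fixed compact disc
    contributes a constant times [v (|z|)], which is small because [v] tends to [0]. In the
    converse, the disc carrying Cauchy's estimate is pushed to the boundary together with [z].

    The base 16 in the lacunary exponents is chosen because [sqrt N_k] is then of order [4^k]: half
    of the factor [1 - r] in [w] gains [4^(-k)], which beats the coefficient [2^k], and the other
    half is left over to give decay at the boundary. *)

Definition cderiv (f : C -> C) (z l : C) : Prop :=
  forall eps, 0 < eps -> exists delta, 0 < delta /\
    forall u, Cmod (u - z) < delta ->
      Cmod (f u - f z - l * (u - z)) <= eps * Cmod (u - z).

Definition ccont (f : C -> C) (z : C) : Prop :=
  forall eps, 0 < eps -> exists delta, 0 < delta /\
    forall u, Cmod (u - z) < delta -> Cmod (f u - f z) < eps.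

Lemma is_derive_cderiv (f : C -> C) (z l : C) :
  is_derive (K := C_AbsRing) (V := C_NormedModule) f z l <-> cderiv f z l.
Proof.
split.
- intros [_ H] eps Heps.
  destruct (H z (fun P HP => HP) (mkposreal eps Heps)) as [d Hd].
  exists d; split; [apply cond_pos | intros u Hu].
  replace (f u - f z - l * (u - z))%C with (minus (minus (f u) (f z)) (scal (minus u z) l)).
  2: { unfold minus, plus, opp, scal; simpl. unfold mult; simpl. ring. }
  exact (Hd u Hu).
- intros H; split.
  + apply is_linear_scal_l.
  + intros x Hx eps.
    (* [is_derive] asks for the expansion at every limit [x] of [locally z]; limits being unique,
       this is [z] alone. *)
    assert (Ex : z = x).
    { apply (is_filter_lim_locally_unique (K := C_AbsRing) (V := AbsRing_NormedModule C_AbsRing)), Hx. }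
    subst x.
    destruct (H eps (cond_pos eps)) as [d [Hd1 Hd2]].
    exists (mkposreal d Hd1). intros u Hu.
    specialize (Hd2 u Hu).
    replace (f u - f z - l * (u - z))%C with (minus (minus (f u) (f z)) (scal (minus u z) l)) in Hd2.
    2: { unfold minus, plus, opp, scal; simpl. unfold mult; simpl. ring. }
    exact Hd2.
Qed.

Lemma ex_derive_cderiv (f : C -> C) (z : C) :
  ex_derive (K := C_AbsRing) (V := C_NormedModule) f z <-> exists l, cderiv f z l.
Proof.
split; intros [l Hl]; exists l; apply is_derive_cderiv, Hl.
Qed.

Lemma cderiv_ccont (f : C -> C) (z l : C) : cderiv f z l -> ccont f z.
Proof.
intros H eps Heps.
destruct (H 1 Rlt_0_1) as [d [Hd1 Hd2]].
assert (Hl := Cmod_ge_0 l).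
assert (Hp : 0 < eps / (2 + Cmod l)) by (apply Rdiv_lt_0_compat; lra).
exists (Rmin d (eps / (2 + Cmod l))); split; [now apply Rmin_glb_lt|].
intros u Hu.
specialize (Hd2 u (Rlt_le_trans _ _ _ Hu (Rmin_l _ _))).
replace (f u - f z)%C with ((f u - f z - l * (u - z)) + l * (u - z))%C by ring.
apply Rle_lt_trans with (1 := Cmod_triangle _ _).
rewrite Cmod_mult.
assert (Hu2 := Rlt_le_trans _ _ _ Hu (Rmin_r _ _)).
apply Rle_lt_trans with ((1 + Cmod l) * Cmod (u - z)); [lra|].
assert (Cmod (u - z) * (2 + Cmod l) < eps).
{ apply (Rmult_lt_reg_r (/ (2 + Cmod l))). now apply Rinv_0_lt_compat; lra.
  rewrite Rmult_assoc, Rinv_r by lra. unfold Rdiv in Hu2. lra. }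
assert (Hr := Cmod_ge_0 (u - z)). nra.
Qed.

Lemma cderiv_const (c z : C) : cderiv (fun _ => c) z 0.
Proof.
intros eps Heps; exists 1; split; [lra|]; intros u _.
replace (c - c - 0 * (u - z))%C with (RtoC 0) by ring.
rewrite Cmod_0. assert (H := Cmod_ge_0 (u - z)). nra.
Qed.

Lemma cderiv_id (z : C) : cderiv (fun u => u) z 1.
Proof.
intros eps Heps; exists 1; split; [lra|]; intros u _.
replace (u - z - 1 * (u - z))%C with (RtoC 0) by ring.
rewrite Cmod_0. assert (H := Cmod_ge_0 (u - z)). nra.
Qed.

Lemma cderiv_plus (f g : C -> C) (z l m : C) :
  cderiv f z l -> cderiv g z m -> cderiv (fun u => f u + g u)%C z (l + m).
Proof.
intros Hf Hg eps Heps.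
destruct (Hf (eps / 2)) as [d1 [Hd1 H1]]; [lra|].
destruct (Hg (eps / 2)) as [d2 [Hd2 H2]]; [lra|].
exists (Rmin d1 d2); split; [now apply Rmin_glb_lt|]; intros u Hu.
specialize (H1 u (Rlt_le_trans _ _ _ Hu (Rmin_l _ _))).
specialize (H2 u (Rlt_le_trans _ _ _ Hu (Rmin_r _ _))).
replace (f u + g u - (f z + g z) - (l + m) * (u - z))%C
  with ((f u - f z - l * (u - z)) + (g u - g z - m * (u - z)))%C by ring.
apply Rle_trans with (1 := Cmod_triangle _ _). lra.
Qed.

Lemma cderiv_minus (f g : C -> C) (z l m : C) :
  cderiv f z l -> cderiv g z m -> cderiv (fun u => f u - g u)%C z (l - m).
Proof.
intros Hf Hg eps Heps.
destruct (Hf (eps / 2)) as [d1 [Hd1 H1]]; [lra|].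
destruct (Hg (eps / 2)) as [d2 [Hd2 H2]]; [lra|].
exists (Rmin d1 d2); split; [now apply Rmin_glb_lt|]; intros u Hu.
specialize (H1 u (Rlt_le_trans _ _ _ Hu (Rmin_l _ _))).
specialize (H2 u (Rlt_le_trans _ _ _ Hu (Rmin_r _ _))).
replace (f u - g u - (f z - g z) - (l - m) * (u - z))%C
  with ((f u - f z - l * (u - z)) - (g u - g z - m * (u - z)))%C by ring.
apply Rle_trans with (1 := Cmod_triangle _ _). rewrite Cmod_opp. lra.
Qed.

Lemma cderiv_mult (f g : C -> C) (z l m : C) :
  cderiv f z l -> cderiv g z m ->
  cderiv (fun u => f u * g u)%C z (l * g z + f z * m).
Proof.
intros Hf Hg eps Heps.
set (A := 1 + Cmod (g z) + Cmod l + Cmod (f z)).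
assert (Hgz := Cmod_ge_0 (g z)). assert (Hlz := Cmod_ge_0 l). assert (Hfz := Cmod_ge_0 (f z)).
assert (HA : 1 <= A) by (unfold A; lra).
assert (He : 0 < eps / A) by (apply Rdiv_lt_0_compat; lra).
destruct (Hf _ He) as [d1 [Hd1 H1]].
destruct (Hg _ He) as [d2 [Hd2 H2]].
destruct (cderiv_ccont _ _ _ Hg _ (Rmin_glb_lt _ _ _ Rlt_0_1 He)) as [d3 [Hd3 H3]].
exists (Rmin d1 (Rmin d2 d3)); split; [now repeat apply Rmin_glb_lt|]; intros u Hu.
specialize (H1 u (Rlt_le_trans _ _ _ Hu (Rmin_l _ _))).
assert (Hu' := Rlt_le_trans _ _ _ Hu (Rmin_r _ _)).
specialize (H2 u (Rlt_le_trans _ _ _ Hu' (Rmin_l _ _))).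
specialize (H3 u (Rlt_le_trans _ _ _ Hu' (Rmin_r _ _))).
assert (H3a := Rlt_le_trans _ _ _ H3 (Rmin_l _ _)).
assert (H3b := Rlt_le_trans _ _ _ H3 (Rmin_r _ _)).
replace (f u * g u - f z * g z - (l * g z + f z * m) * (u - z))%C
  with ((f u - f z - l * (u - z)) * g u + l * (u - z) * (g u - g z)
        + f z * (g u - g z - m * (u - z)))%C by ring.
apply Rle_trans with (1 := Cmod_triangle _ _).
apply Rle_trans with (1 := Rplus_le_compat_r _ _ _ (Cmod_triangle _ _)).
rewrite !Cmod_mult.
assert (Hgu : Cmod (g u) <= 1 + Cmod (g z)).
{ replace (g u) with ((g u - g z) + g z)%C by ring.
  apply Rle_trans with (1 := Cmod_triangle _ _). lra. }
set (r := Cmod (u - z)) in *.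
assert (Hr : 0 <= r) by apply Cmod_ge_0.
apply Rle_trans with (eps / A * r * (1 + Cmod (g z)) + Cmod l * r * (eps / A) + Cmod (f z) * (eps / A * r)).
{ repeat apply Rplus_le_compat.
  - apply Rmult_le_compat; try apply Cmod_ge_0; lra.
  - apply Rmult_le_compat_l; [|lra]. now apply Rmult_le_pos.
  - apply Rmult_le_compat_l; lra. }
replace (eps / A * r * (1 + Cmod (g z)) + Cmod l * r * (eps / A) + Cmod (f z) * (eps / A * r))
  with (eps / A * A * r) by (unfold A; ring).
replace (eps / A * A) with eps by (field; lra). lra.
Qed.

Lemma cderiv_inv (z : C) : z <> 0%C -> cderiv Cinv z (- / (z * z)).
Proof.
intros Hz eps Heps.
assert (Hm := proj1 (Cmod_gt_0 z) Hz). set (m := Cmod z) in *.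
(* The remainder is exactly [(u - z)^2 / (u z^2)]. The first radius keeps [|u| > m / 2], the second
   then makes the quotient at most [eps |u - z|]. *)
exists (Rmin (m / 2) (eps * m * m * m / 2)); split.
{ apply Rmin_glb_lt; [lra|]. apply Rdiv_lt_0_compat; [|lra].
  now repeat apply Rmult_lt_0_compat. }
intros u Hu.
assert (H1 := Rlt_le_trans _ _ _ Hu (Rmin_l _ _)).
assert (H2 := Rlt_le_trans _ _ _ Hu (Rmin_r _ _)).
assert (Hmu : m / 2 < Cmod u).
{ assert (T := Cmod_triangle u (z - u)).
  replace (u + (z - u))%C with z in T by ring. fold m in T.
  replace (z - u)%C with (- (u - z))%C in T by ring. rewrite Cmod_opp in T. lra. }
assert (Hu0 : u <> 0%C). { apply Cmod_gt_0. lra. }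
replace (/ u - / z - - / (z * z) * (u - z))%C
  with ((u - z) * (u - z) / (u * z * z))%C by (field; split; assumption).
rewrite Cmod_div, !Cmod_mult by (repeat apply Cmult_neq_0; assumption).
fold m. set (r := Cmod (u - z)) in *. set (k := Cmod u) in *.
assert (Hr : 0 <= r) by apply Cmod_ge_0.
apply (Rmult_le_reg_r (k * m * m)). { now repeat apply Rmult_lt_0_compat; try lra. }
unfold Rdiv. rewrite Rmult_assoc, Rinv_l.
2: { apply Rgt_not_eq. now repeat apply Rmult_lt_0_compat; try lra. }
replace (eps * r * (k * m * m)) with (r * (eps * m * m * k)) by ring.
rewrite Rmult_1_r. apply Rmult_le_compat_l; [exact Hr|].
assert (0 < eps * m * m) by (repeat apply Rmult_lt_0_compat; lra). nra.
Qed.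

Lemma cderiv_comp (f g : C -> C) (z l m : C) :
  cderiv f z l -> cderiv g (f z) m -> cderiv (fun u => g (f u)) z (m * l).
Proof.
intros Hf Hg eps Heps.
assert (Hl := Cmod_ge_0 l). assert (Hm := Cmod_ge_0 m).
set (A := 1 + Cmod l + Cmod m).
assert (HA : 1 <= A) by (unfold A; lra).
set (e := Rmin 1 (eps / A)).
assert (He : 0 < e). { apply Rmin_glb_lt; [lra|]. apply Rdiv_lt_0_compat; lra. }
destruct (Hg e He) as [d1 [Hd1 H1]].
destruct (Hf e He) as [d2 [Hd2 H2]].
destruct (cderiv_ccont _ _ _ Hf _ Hd1) as [d3 [Hd3 H3]].
exists (Rmin d2 d3); split; [now apply Rmin_glb_lt|]; intros u Hu.
specialize (H2 u (Rlt_le_trans _ _ _ Hu (Rmin_l _ _))).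
specialize (H3 u (Rlt_le_trans _ _ _ Hu (Rmin_r _ _))).
specialize (H1 _ H3).
replace (g (f u) - g (f z) - m * l * (u - z))%C
  with ((g (f u) - g (f z) - m * (f u - f z)) + m * (f u - f z - l * (u - z)))%C by ring.
apply Rle_trans with (1 := Cmod_triangle _ _). rewrite Cmod_mult.
assert (Hfu : Cmod (f u - f z) <= (1 + Cmod l) * Cmod (u - z)).
{ replace (f u - f z)%C with ((f u - f z - l * (u - z)) + l * (u - z))%C by ring.
  apply Rle_trans with (1 := Cmod_triangle _ _). rewrite Cmod_mult.
  assert (e <= 1) by apply Rmin_l. assert (Hr := Cmod_ge_0 (u - z)). nra. }
assert (Hr := Cmod_ge_0 (u - z)).
apply Rle_trans with (e * ((1 + Cmod l) * Cmod (u - z)) + Cmod m * (e * Cmod (u - z))).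
{ apply Rplus_le_compat.
  - apply Rle_trans with (1 := H1). apply Rmult_le_compat_l; lra.
  - now apply Rmult_le_compat_l. }
replace (e * ((1 + Cmod l) * Cmod (u - z)) + Cmod m * (e * Cmod (u - z)))
  with (e * A * Cmod (u - z)) by (unfold A; ring).
apply Rmult_le_compat_r; [exact Hr|].
apply Rle_trans with (eps / A * A); [apply Rmult_le_compat_r; [lra|apply Rmin_r]|].
right; field; lra.
Qed.

(** Integrability is stated for the product uniform structure on [C], while [ccont] uses the
    modulus; [locally_C] identifies the two kinds of neighbourhoods. *)
Lemma ccont_continuous (f : C -> C) (z : C) :
  ccont f z -> continuous (T := C_UniformSpace) (U := C_UniformSpace) f z.
Proof.
intros H.
assert (K : filterlim f (locally (T := C_UniformSpace) z) (locally (T := C_UniformSpace) (f z))); [|exact K].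
intros P HP. apply locally_C in HP. apply locally_C.
destruct HP as [e He].
destruct (H e (cond_pos e)) as [d [Hd1 Hd2]].
exists (mkposreal d Hd1). intros u Hu. apply He. exact (Hd2 u Hu).
Qed.

(** * Integrals along segments *)

Notation CRInt := (RInt (V := C_R_CompleteNormedModule)).
Notation ex_CRInt := (ex_RInt (V := C_R_CompleteNormedModule)).
Notation is_CRInt := (is_RInt (V := C_R_CompleteNormedModule)).

Definition cont_on_seg (f : C -> C) (a b : C) : Prop :=
  forall t : R, 0 <= t <= 1 -> ccont f (a + t * (b - a))%C.

Lemma Cmod_norm_R (z : C) : norm (V := C_R_CompleteNormedModule) z = Cmod z.
Proof. rewrite Cmod_norm. reflexivity. Qed.

Lemma continuous_seg (a b : C) (t : R) :
  continuous (U := C_R_CompleteNormedModule) (fun t : R => a + t * (b - a))%C t.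
Proof.
apply (continuous_ext (fun t : R => plus (G := C_R_CompleteNormedModule) a (scal t (b - a)%C))).
{ intros x. now rewrite scal_R_Cmult. }
apply (continuous_plus (V := C_R_CompleteNormedModule)); [apply continuous_const|].
apply (continuous_scal_l (V := C_R_CompleteNormedModule)). apply continuous_id.
Qed.

Lemma ex_CRInt_seg (f : C -> C) (a b : C) :
  cont_on_seg f a b -> ex_CRInt (fun t : R => f (a + t * (b - a))%C) 0 1.
Proof.
intros H. apply (ex_RInt_continuous (V := C_R_CompleteNormedModule)).
intros t Ht. rewrite Rmin_left, Rmax_right in Ht by lra.
apply (continuous_comp (U := R_UniformSpace) (V := C_UniformSpace) (W := C_UniformSpace)
  (fun t : R => a + t * (b - a))%C f).
- apply continuous_seg.
- apply ccont_continuous, H, Ht.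
Qed.

(** The integral lives in a real normed module, so a complex factor is pulled out through the real
    and imaginary components. *)
Lemma is_CRInt_Cmult (f : R -> C) (c l : C) (a b : R) :
  is_CRInt f a b l -> is_CRInt (fun t => c * f t)%C a b (c * l)%C.
Proof.
intros H.
assert (H1 := is_RInt_fct_extend_fst (U := R_NormedModule) (V := R_NormedModule) _ _ _ _ H).
assert (H2 := is_RInt_fct_extend_snd (U := R_NormedModule) (V := R_NormedModule) _ _ _ _ H).
apply (is_RInt_fct_extend_pair (U := R_NormedModule) (V := R_NormedModule)); simpl.
- apply (is_RInt_minus (V := R_NormedModule));
  apply (is_RInt_scal (V := R_NormedModule)); assumption.
- apply (is_RInt_plus (V := R_NormedModule));
  apply (is_RInt_scal (V := R_NormedModule)); assumption.
Qed.

Lemma CRInt_Cmult (f : R -> C) (c : C) (a b : R) :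
  ex_CRInt f a b -> CRInt (fun t => c * f t)%C a b = (c * CRInt f a b)%C.
Proof.
intros H. apply (is_RInt_unique (V := C_R_CompleteNormedModule)), is_CRInt_Cmult.
exact (RInt_correct (V := C_R_CompleteNormedModule) _ _ _ H).
Qed.

Lemma CRInt_le (f : R -> C) (F : R -> R) (I : R) :
  ex_CRInt f 0 1 -> is_RInt F 0 1 I ->
  (forall t, 0 <= t <= 1 -> Cmod (f t) <= F t) -> Cmod (CRInt f 0 1) <= I.
Proof.
intros H HF Hle. rewrite <- Cmod_norm_R.
apply (norm_RInt_le (V := C_R_CompleteNormedModule) f F 0 1); [lra| | |exact HF].
- intros t Ht. rewrite Cmod_norm_R. now apply Hle.
- exact (RInt_correct (V := C_R_CompleteNormedModule) _ _ _ H).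
Qed.

Lemma CRInt_le_const (f : R -> C) (M : R) :
  ex_CRInt f 0 1 ->
  (forall t, 0 <= t <= 1 -> Cmod (f t) <= M) -> Cmod (CRInt f 0 1) <= M.
Proof.
intros H Hle. apply (CRInt_le f (fun _ => M)); auto.
assert (K := is_RInt_const (V := R_NormedModule) 0 1 M).
change (scal (1 - 0) M) with ((1 - 0) * M) in K.
replace ((1 - 0) * M) with M in K by ring. exact K.
Qed.

Lemma CRInt_const (c : C) : CRInt (fun _ => c) 0 1 = c.
Proof.
rewrite (RInt_const (V := C_R_CompleteNormedModule)), scal_R_Cmult.
change (@eq C (RtoC (1 - 0) * c)%C c). rewrite RtoC_minus. ring.
Qed.

Lemma CRInt_minus (f g : R -> C) :
  ex_CRInt f 0 1 -> ex_CRInt g 0 1 ->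
  CRInt (fun t => f t - g t)%C 0 1 = (CRInt f 0 1 - CRInt g 0 1)%C.
Proof. exact (RInt_minus (V := C_R_CompleteNormedModule) f g 0 1). Qed.

Lemma CRInt_ext (f g : R -> C) :
  (forall t, 0 <= t <= 1 -> f t = g t) -> CRInt f 0 1 = CRInt g 0 1.
Proof.
intros H. apply (RInt_ext (V := C_R_CompleteNormedModule)).
intros t Ht. rewrite Rmin_left, Rmax_right in Ht by lra. apply H; lra.
Qed.

Lemma Cint_seg_bound (f : C -> C) (a b : C) (M : R) :
  cont_on_seg f a b ->
  (forall t : R, 0 <= t <= 1 -> Cmod (f (a + t * (b - a))%C) <= M) ->
  Cmod (Cint_seg f a b) <= Cmod (b - a) * M.
Proof.
intros H Hle. unfold Cint_seg. rewrite Cmod_mult.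
apply Rmult_le_compat_l; [apply Cmod_ge_0|].
apply CRInt_le_const; [now apply ex_CRInt_seg | exact Hle].
Qed.

Lemma Cint_seg_minus (f g : C -> C) (a b : C) :
  cont_on_seg f a b -> cont_on_seg g a b ->
  Cint_seg (fun z => f z - g z)%C a b = (Cint_seg f a b - Cint_seg g a b)%C.
Proof.
intros Hf Hg. unfold Cint_seg. rewrite CRInt_minus; [ring | now apply ex_CRInt_seg ..].
Qed.

Lemma Cint_seg_const (c a b : C) : Cint_seg (fun _ => c) a b = ((b - a) * c)%C.
Proof. unfold Cint_seg. now rewrite CRInt_const. Qed.

Lemma is_CRInt_reparam (F : R -> C) (u v : R) (I : C) :
  is_CRInt F v (u + v) I -> is_CRInt (fun t => u * F (u * t + v)%R)%C 0 1 I.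
Proof.
intros H.
apply (is_RInt_ext (V := C_R_CompleteNormedModule)
  (fun t => scal (V := C_R_CompleteNormedModule) u (F (u * t + v)))).
{ intros t _. now rewrite scal_R_Cmult. }
apply (is_RInt_comp_lin (V := C_R_CompleteNormedModule) F u v 0 1).
now rewrite Rmult_0_r, Rmult_1_r, Rplus_0_l.
Qed.

(** The points [a'] and [b'] have parameters [v] and [u + v] on the segment from [a] to [b]. Since
    [u] may be negative, this one change of variable yields both the reversal of a segment
    ([u = -1], [v = 1]) and its subdivision. *)
Lemma Cint_subseg (f : C -> C) (a b a' b' : C) (u v : R) (I : C) :
  a' = (a + v * (b - a))%C -> b' = (a + (u + v)%R * (b - a))%C ->
  is_CRInt (fun t : R => f (a + t * (b - a))%C) v (u + v) I ->
  cont_on_seg f a' b' ->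
  Cint_seg f a' b' = ((b - a) * I)%C.
Proof.
intros Ea Eb H Hc.
assert (K := is_CRInt_reparam _ _ _ _ H).
apply (is_RInt_unique (V := C_R_CompleteNormedModule)) in K.
unfold Cint_seg. rewrite <- K.
assert (Ed : (b' - a' = (b - a) * u)%C) by (rewrite Ea, Eb, RtoC_plus; ring).
transitivity ((b - a) * (u * CRInt (fun t : R => f (a' + t * (b' - a'))%C) 0 1))%C.
{ rewrite Ed. ring. }
rewrite <- (CRInt_Cmult (fun t : R => f (a' + t * (b' - a'))%C)) by now apply ex_CRInt_seg.
f_equal. apply CRInt_ext. intros t _. f_equal. f_equal.
rewrite Ea, Eb, !RtoC_plus, RtoC_mult. ring.
Qed.

Lemma cont_on_seg_swap (f : C -> C) (a b : C) : cont_on_seg f a b -> cont_on_seg f b a.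
Proof.
intros H t Ht. replace (b + t * (a - b))%C with (a + (1 - t)%R * (b - a))%C.
- apply H. lra.
- rewrite RtoC_minus. ring.
Qed.

Lemma cont_on_subseg (f : C -> C) (a b : C) (s t : R) :
  0 <= s <= 1 -> 0 <= t <= 1 -> cont_on_seg f a b ->
  cont_on_seg f (a + s * (b - a)) (a + t * (b - a)).
Proof.
intros Hs Ht H x Hx.
replace (a + s * (b - a) + x * (a + t * (b - a) - (a + s * (b - a))))%C
  with (a + (s + x * (t - s))%R * (b - a))%C.
- apply H. nra.
- rewrite RtoC_plus, RtoC_mult, RtoC_minus. ring.
Qed.

Lemma Cint_seg_swap (f : C -> C) (a b : C) :
  cont_on_seg f a b -> Cint_seg f b a = (- Cint_seg f a b)%C.
Proof.
intros H.
assert (K := RInt_correct (V := C_R_CompleteNormedModule) _ _ _ (ex_CRInt_seg f a b H)).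
apply (is_RInt_swap (V := C_R_CompleteNormedModule)) in K.
replace 0 with (-1 + 1) in K at 1 by ring.
rewrite (Cint_subseg f a b b a (-1) 1 _) with (3 := K).
- unfold Cint_seg. change (opp ?x) with (- x)%C. ring.
- ring.
- replace (-1 + 1) with 0 by ring. ring.
- now apply cont_on_seg_swap.
Qed.

Lemma Cint_seg_split (f : C -> C) (a b : C) (s : R) :
  0 <= s <= 1 -> cont_on_seg f a b ->
  Cint_seg f a b =
  (Cint_seg f a (a + s * (b - a)) + Cint_seg f (a + s * (b - a)) b)%C.
Proof.
intros Hs H.
set (F := fun t : R => f (a + t * (b - a))%C).
assert (Hex := ex_CRInt_seg f a b H).
assert (H1 : ex_CRInt F 0 s) by (apply (ex_RInt_Chasles_1 (V := C_R_CompleteNormedModule) F 0 s 1); auto).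
assert (H2 : ex_CRInt F s 1) by (apply (ex_RInt_Chasles_2 (V := C_R_CompleteNormedModule) F 0 s 1); auto).
assert (Ea : a = (a + 0%R * (b - a))%C) by ring.
assert (Eb : b = (a + 1%R * (b - a))%C) by ring.
rewrite (Cint_subseg f a b a (a + s * (b - a)) s 0 (CRInt F 0 s)).
- rewrite (Cint_subseg f a b (a + s * (b - a)) b (1 - s) s (CRInt F s 1)).
  + unfold Cint_seg. fold F.
    rewrite <- (RInt_Chasles (V := C_R_CompleteNormedModule) F 0 s 1) by assumption.
    change (plus ?x ?y) with (x + y)%C.
    ring.
  + reflexivity.
  + replace (1 - s + s) with 1 by ring. exact Eb.
  + replace (1 - s + s) with 1 by ring. exact (RInt_correct (V := C_R_CompleteNormedModule) _ _ _ H2).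
  + rewrite Eb at 2. apply cont_on_subseg; auto; lra.
- exact Ea.
- now rewrite Rplus_0_r.
- rewrite Rplus_0_r. exact (RInt_correct (V := C_R_CompleteNormedModule) _ _ _ H1).
- rewrite Ea at 1. apply cont_on_subseg; auto; lra.
Qed.

(** * Goursat's theorem *)

Definition Ctri (f : C -> C) (a b c : C) : C :=
  (Cint_seg f a b + Cint_seg f b c + Cint_seg f c a)%C.

Definition perimeter (a b c : C) : R := Cmod (b - a) + Cmod (c - b) + Cmod (a - c).

Definition convex (D : C -> Prop) : Prop :=
  forall a b (t : R), D a -> D b -> 0 <= t <= 1 -> D (a + t * (b - a))%C.

Definition adherence_closed (D : C -> Prop) : Prop :=
  forall p, (forall eps, 0 < eps -> exists q, D q /\ Cmod (q - p) < eps) -> D p.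

Lemma Cmod_minus_sym (a b : C) : Cmod (a - b) = Cmod (b - a).
Proof. rewrite <- Cmod_opp. f_equal. ring. Qed.

Lemma Cmod_scal_R (t : R) (z : C) : 0 <= t -> Cmod (t * z) = t * Cmod z.
Proof. intros Ht. rewrite Cmod_mult, Cmod_R, Rabs_pos_eq by assumption. reflexivity. Qed.

Lemma is_CRInt_id : is_CRInt (fun t : R => RtoC t) 0 1 (RtoC (/ 2)).
Proof.
apply (is_RInt_fct_extend_pair (U := R_NormedModule) (V := R_NormedModule)); simpl.
- assert (K := is_RInt_derive (V := R_CompleteNormedModule) (fun t => t * t / 2) (fun t => t) 0 1).
  replace (/ 2) with (1 * 1 / 2 - 0 * 0 / 2) by field.
  apply K; intros x _; [|apply continuous_id].
  auto_derive; [exact I | field].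
- assert (K := is_RInt_const (V := R_NormedModule) 0 1 0).
  change (scal (1 - 0) 0) with ((1 - 0) * 0) in K.
  replace ((1 - 0) * 0) with 0 in K by ring. exact K.
Qed.

(** The midpoint rule is exact on affine functions. In this closed form the three sides of a
    triangle telescope to zero. *)
Lemma Cint_seg_affine (A B p a b : C) :
  Cint_seg (fun z => A + B * (z - p))%C a b
  = ((b - a) * (A + B * ((a + b) / 2 - p)))%C.
Proof.
unfold Cint_seg. f_equal.
apply (is_RInt_unique (V := C_R_CompleteNormedModule)).
apply (is_RInt_ext (V := C_R_CompleteNormedModule)
  (fun t : R => plus (G := C_R_CompleteNormedModule) (A + B * (a - p))%C (B * (b - a) * t)%C)).
{ intros t _.
  change (@eq C (A + B * (a - p) + B * (b - a) * t) (A + B * (a + t * (b - a) - p)))%C. ring. }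
replace (A + B * ((a + b) / 2 - p))%C
  with (plus (G := C_R_CompleteNormedModule) (A + B * (a - p))%C (B * (b - a) * (/ 2)%R)%C).
2: { change (@eq C (A + B * (a - p) + B * (b - a) * (/ 2)%R) (A + B * ((a + b) / 2 - p)))%C.
     rewrite RtoC_inv by lra. field. }
apply (is_RInt_plus (V := C_R_CompleteNormedModule)).
- assert (K := is_RInt_const (V := C_R_CompleteNormedModule) 0 1 (A + B * (a - p))%C).
  rewrite scal_R_Cmult in K.
  replace (RtoC (1 - 0) * (A + B * (a - p)))%C with (A + B * (a - p))%C in K.
  + exact K.
  + rewrite RtoC_minus. ring.
- apply is_CRInt_Cmult, is_CRInt_id.
Qed.

Lemma Ctri_affine (A B p a b c : C) : Ctri (fun z => A + B * (z - p))%C a b c = 0.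
Proof.
unfold Ctri. rewrite !Cint_seg_affine. field.
Qed.

Lemma cderiv_affine (A B p z : C) : cderiv (fun z => A + B * (z - p))%C z B.
Proof.
intros eps Heps; exists 1; split; [lra|]; intros u _.
replace (A + B * (u - p) - (A + B * (z - p)) - B * (u - z))%C with (RtoC 0) by ring.
rewrite Cmod_0. apply Rmult_le_pos; [lra | apply Cmod_ge_0].
Qed.

Lemma Ctri_bound (f : C -> C) (a b c : C) (M : R) :
  cont_on_seg f a b -> cont_on_seg f b c -> cont_on_seg f c a ->
  (forall z, Cmod (z - a) <= perimeter a b c -> Cmod (f z) <= M) ->
  Cmod (Ctri f a b c) <= perimeter a b c * M.
Proof.
intros Hab Hbc Hca HM.
assert (P1 := Cmod_ge_0 (b - a)). assert (P2 := Cmod_ge_0 (c - b)). assert (P3 := Cmod_ge_0 (a - c)).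
unfold Ctri.
apply Rle_trans with (1 := Cmod_triangle _ _).
apply Rle_trans with (1 := Rplus_le_compat_r _ _ _ (Cmod_triangle _ _)).
replace (perimeter a b c * M) with (Cmod (b - a) * M + Cmod (c - b) * M + Cmod (a - c) * M)
  by (unfold perimeter; ring).
repeat apply Rplus_le_compat; apply Cint_seg_bound; auto; intros t Ht; apply HM; unfold perimeter.
- replace (a + t * (b - a) - a)%C with (t * (b - a))%C by ring.
  rewrite Cmod_scal_R by lra. nra.
- replace (b + t * (c - b) - a)%C with ((b - a) + t * (c - b))%C by ring.
  apply Rle_trans with (1 := Cmod_triangle _ _). rewrite Cmod_scal_R by lra. nra.
- replace (c + t * (a - c) - a)%C with ((1 - t)%R * (c - a))%C by (rewrite RtoC_minus; ring).
  rewrite Cmod_scal_R, Cmod_minus_sym by lra. nra.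
Qed.

Definition mid (a b : C) : C := (a + (/ 2)%R * (b - a))%C.

(** The increments form a series dominated by a geometric one, and the distance to its limit is at
    most the tail [L / 2^n + L / 2^(n+1) + ...]. *)
Lemma Cseq_limit (a : nat -> C) (L : R) :
  (forall n, Cmod (a (S n) - a n) <= L / 2 ^ n) ->
  exists p, forall n, Cmod (a n - p) <= 2 * (L / 2 ^ n).
Proof.
intros H.
assert (HL : 0 <= L).
{ assert (K := H O). assert (K2 := Cmod_ge_0 (a 1%nat - a O)). simpl in K. lra. }
assert (Hpow : forall n, 0 < 2 ^ n) by (intros n; apply pow_lt; lra).
assert (Hex : ex_series (K := R_AbsRing) (V := C_R_CompleteNormedModule) (fun n => a (S n) - a n)%C).
{ apply (ex_series_le (K := R_AbsRing) (V := C_R_CompleteNormedModule) _ (fun n => L * (/ 2) ^ n)).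
  - intros n. rewrite Cmod_norm_R. rewrite pow_inv. apply H.
  - apply (ex_series_scal (V := R_NormedModule) L (fun n => (/ 2) ^ n)). apply ex_series_geom. rewrite Rabs_pos_eq; lra. }
destruct Hex as [s Hs].
exists (a O + s)%C.
assert (Hsum : forall n, sum_n (G := C_R_CompleteNormedModule) (fun n => a (S n) - a n)%C n = (a (S n) - a O)%C).
{ induction n as [|n IH].
  - rewrite sum_O. reflexivity.
  - rewrite sum_Sn, IH.
    change (@eq C ((a (S n) - a O) + (a (S (S n)) - a (S n))) (a (S (S n)) - a O))%C. ring. }
(* Subtracting the tail beyond [n + k] makes the bound exact enough for the induction on [k] to
   close. *)
assert (Hdist : forall k n, Cmod (a n - a (n + k)%nat) <= 2 * (L / 2 ^ n) - 2 * (L / 2 ^ (n + k))).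
{ induction k as [|k IH]; intros n.
  - rewrite Nat.add_0_r. replace (a n - a n)%C with (RtoC 0) by ring. rewrite Cmod_0. lra.
  - replace (a n - a (n + S k)%nat)%C with ((a n - a (n + k)%nat) + (a (n + k)%nat - a (n + S k)%nat))%C by ring.
    apply Rle_trans with (1 := Cmod_triangle _ _).
    assert (K := H (n + k)%nat). rewrite <- Nat.add_succ_r in K. rewrite Cmod_minus_sym in K.
    specialize (IH n).
    assert (E : L / 2 ^ (n + S k) = L / 2 ^ (n + k) / 2).
    { rewrite Nat.add_succ_r. simpl. field. apply pow_nonzero. lra. }
    rewrite E. lra. }
intros n. apply le_epsilon. intros eps Heps.
assert (Hloc := proj1 (filterlim_locally_ball_norm (K := R_AbsRing) (U := C_R_CompleteNormedModule) _ _) Hs (mkposreal eps Heps)).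
destruct Hloc as [N HN].
specialize (HN (n + N)%nat ltac:(lia)). unfold ball_norm in HN. rewrite Hsum in HN.
rewrite Cmod_norm_R in HN.
assert (HN' : Cmod (a (S (n + N)) - a O - s) < eps) by exact HN.
specialize (Hdist (S N) n). rewrite Nat.add_succ_r in Hdist.
replace (a n - (a O + s))%C with ((a n - a (S (n + N))) + (a (S (n + N)) - a O - s))%C by ring.
apply Rle_trans with (1 := Cmod_triangle _ _).
assert (0 <= L / 2 ^ (S (n + N))). { apply Rdiv_le_0_compat; auto. }
lra.
Qed.

Section Goursat.
Variables (f : C -> C) (D : C -> Prop).
Hypothesis D_convex : convex D.
Hypothesis f_cont : forall z, D z -> ccont f z.

Lemma convex_cont_on_seg (a b : C) : D a -> D b -> cont_on_seg f a b.
Proof. intros Ha Hb t Ht. now apply f_cont, D_convex. Qed.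

Lemma convex_mid (a b : C) : D a -> D b -> D (mid a b).
Proof. intros Ha Hb. apply D_convex; auto. lra. Qed.

(** The sides of the medial triangle are each run through twice, in opposite directions, and
    cancel. *)
Lemma Ctri_subdivide (a b c : C) : D a -> D b -> D c ->
  Ctri f a b c =
  (Ctri f a (mid a b) (mid c a) + Ctri f (mid a b) b (mid b c)
   + Ctri f (mid c a) (mid b c) c + Ctri f (mid b c) (mid c a) (mid a b))%C.
Proof.
intros Ha Hb Hc.
assert (Hab := convex_mid a b Ha Hb). assert (Hbc := convex_mid b c Hb Hc).
assert (Hca := convex_mid c a Hc Ha).
unfold Ctri.
rewrite (Cint_seg_split f a b (/ 2)) by (try apply convex_cont_on_seg; auto; lra).
rewrite (Cint_seg_split f b c (/ 2)) by (try apply convex_cont_on_seg; auto; lra).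
rewrite (Cint_seg_split f c a (/ 2)) by (try apply convex_cont_on_seg; auto; lra).
fold (mid a b) (mid b c) (mid c a).
rewrite (Cint_seg_swap f (mid a b) (mid c a)) by now apply convex_cont_on_seg.
rewrite (Cint_seg_swap f (mid a b) (mid b c)) by now apply convex_cont_on_seg.
rewrite (Cint_seg_swap f (mid b c) (mid c a)) by now apply convex_cont_on_seg.
ring.
Qed.

(** One of the four pieces carries at least a quarter of the integral, and all have half the
    perimeter. The bound on the displacement of the first vertex makes the nested vertices a Cauchy
    sequence. *)
Lemma goursat_step (a b c : C) : D a -> D b -> D c ->
  exists a' b' c', (D a' /\ D b' /\ D c') /\
    Cmod (Ctri f a b c) <= 4 * Cmod (Ctri f a' b' c') /\
    perimeter a' b' c' <= perimeter a b c / 2 /\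
    Cmod (a' - a) <= perimeter a b c.
Proof.
intros Ha Hb Hc.
assert (Hab := convex_mid a b Ha Hb). assert (Hbc := convex_mid b c Hb Hc).
assert (Hca := convex_mid c a Hc Ha).
assert (P1 := Cmod_ge_0 (b - a)). assert (P2 := Cmod_ge_0 (c - b)). assert (P3 := Cmod_ge_0 (a - c)).
assert (Half : forall x y, x = ((/ 2)%R * y)%C -> Cmod x = Cmod y / 2).
{ intros x y ->. rewrite Cmod_scal_R by lra. field. }
assert (Half' : forall x y, x = (- ((/ 2)%R * y))%C -> Cmod x = Cmod y / 2).
{ intros x y ->. rewrite Cmod_opp, Cmod_scal_R by lra. field. }
assert (S := Ctri_subdivide a b c Ha Hb Hc).
assert (Hle : Cmod (Ctri f a b c) <=
  Cmod (Ctri f a (mid a b) (mid c a)) + Cmod (Ctri f (mid a b) b (mid b c))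
   + Cmod (Ctri f (mid c a) (mid b c) c) + Cmod (Ctri f (mid b c) (mid c a) (mid a b))).
{ rewrite S. apply Rle_trans with (1 := Cmod_triangle _ _). apply Rplus_le_compat_r.
  apply Rle_trans with (1 := Cmod_triangle _ _). apply Rplus_le_compat_r. apply Cmod_triangle. }
destruct (Rle_dec (Cmod (Ctri f a b c)) (4 * Cmod (Ctri f a (mid a b) (mid c a)))) as [L1|L1];
[|destruct (Rle_dec (Cmod (Ctri f a b c)) (4 * Cmod (Ctri f (mid a b) b (mid b c)))) as [L2|L2];
[|destruct (Rle_dec (Cmod (Ctri f a b c)) (4 * Cmod (Ctri f (mid c a) (mid b c) c))) as [L3|L3]]].
- exists a, (mid a b), (mid c a). repeat split; auto; unfold perimeter.
  + rewrite (Half (mid a b - a)%C (b - a)%C), (Half (mid c a - mid a b)%C (c - b)%C), (Half (a - mid c a)%C (a - c)%C); [lra|..];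
    unfold mid; rewrite RtoC_inv by lra; field.
  + replace (a - a)%C with (RtoC 0) by ring. rewrite Cmod_0. lra.
- exists (mid a b), b, (mid b c). repeat split; auto; unfold perimeter.
  + rewrite (Half (b - mid a b)%C (b - a)%C), (Half (mid b c - b)%C (c - b)%C), (Half (mid a b - mid b c)%C (a - c)%C); [lra|..];
    unfold mid; rewrite RtoC_inv by lra; field.
  + rewrite (Half (mid a b - a)%C (b - a)%C); [lra|]. unfold mid. ring.
- exists (mid c a), (mid b c), c. repeat split; auto; unfold perimeter.
  + rewrite (Half (mid b c - mid c a)%C (b - a)%C), (Half (c - mid b c)%C (c - b)%C), (Half (mid c a - c)%C (a - c)%C); [lra|..];
    unfold mid; rewrite RtoC_inv by lra; field.
  + rewrite (Half' (mid c a - a)%C (a - c)%C); [lra|].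
    unfold mid; rewrite RtoC_inv by lra; field.
- exists (mid b c), (mid c a), (mid a b). repeat split; auto; unfold perimeter.
  + lra.
  + rewrite (Half' (mid c a - mid b c)%C (b - a)%C), (Half' (mid a b - mid c a)%C (c - b)%C), (Half' (mid b c - mid a b)%C (a - c)%C); [lra|..];
    unfold mid; rewrite RtoC_inv by lra; field.
  + replace (mid b c - a)%C with ((b - a) + (/ 2)%R * (c - b))%C by (unfold mid; ring).
    apply Rle_trans with (1 := Cmod_triangle _ _). rewrite Cmod_scal_R by lra. lra.
Qed.

(** Membership in [D] is packed with the vertices so that a choice of subtriangle becomes a map from
    a type to itself, which can be iterated. *)
Let triangle := {T : C * C * C | D (fst (fst T)) /\ D (snd (fst T)) /\ D (snd T)}.
Let vert1 (T : triangle) : C := fst (fst (proj1_sig T)).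
Let vert2 (T : triangle) : C := snd (fst (proj1_sig T)).
Let vert3 (T : triangle) : C := snd (proj1_sig T).
Let tri_int (T : triangle) := Cmod (Ctri f (vert1 T) (vert2 T) (vert3 T)).
Let tri_per (T : triangle) := perimeter (vert1 T) (vert2 T) (vert3 T).

Lemma goursat_sequence (T0 : triangle) : exists T : nat -> triangle,
  T O = T0 /\ forall n,
    tri_int (T n) <= 4 * tri_int (T (S n)) /\
    tri_per (T (S n)) <= tri_per (T n) / 2 /\
    Cmod (vert1 (T (S n)) - vert1 (T n)) <= tri_per (T n).
Proof.
assert (H : forall T : triangle, {T' : triangle |
  tri_int T <= 4 * tri_int T' /\ tri_per T' <= tri_per T / 2 /\ Cmod (vert1 T' - vert1 T) <= tri_per T}).
{ intros [[[a b] c] HT]. apply constructive_indefinite_description.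
  destruct HT as [Ha [Hb Hc]]; simpl in *.
  destruct (goursat_step a b c Ha Hb Hc) as [a' [b' [c' [HD H]]]].
  exists (exist _ (a', b', c') HD). exact H. }
exists (fun n => Nat.iter n (fun T => proj1_sig (H T)) T0).
split; [reflexivity|]. intros n. exact (proj2_sig (H (Nat.iter n (fun T => proj1_sig (H T)) T0))).
Qed.

(** Near the limit point [p] of the vertices, [f] differs from an affine function, whose integral
    vanishes, by [eps |z - p|]. On the triangle at stage [n] both the perimeter and this distance
    are of order [L / 2^n], so the integral is [O (eps L^2 / 4^n)], which the factor [4^n] lost by
    subdividing exactly compensates. Closedness of [D] puts [p] in [D]. *)
Theorem goursat (a b c : C) : adherence_closed D ->
  (forall z, D z -> exists l, cderiv f z l) ->
  D a -> D b -> D c -> Ctri f a b c = 0.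
Proof.
intros D_closed f_diff Ha Hb Hc.
destruct (goursat_sequence (exist _ (a, b, c) (conj Ha (conj Hb Hc)))) as [T [T0 HT]].
set (L := perimeter a b c).
assert (P1 := Cmod_ge_0 (b - a)). assert (P2 := Cmod_ge_0 (c - b)). assert (P3 := Cmod_ge_0 (a - c)).
assert (HL : 0 <= L) by (unfold L, perimeter; lra).
assert (Hper : forall n, tri_per (T n) <= L / 2 ^ n).
{ induction n as [|n IH].
  - rewrite T0. unfold tri_per, vert1, vert2, vert3; simpl. fold L. lra.
  - destruct (HT n) as [_ [H _]]. simpl.
    replace (L / (2 * 2 ^ n)) with (L / 2 ^ n / 2) by (field; apply pow_nonzero; lra). lra. }
assert (Hint : forall n, Cmod (Ctri f a b c) <= 4 ^ n * tri_int (T n)).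
{ induction n as [|n IH].
  - rewrite T0. unfold tri_int, vert1, vert2, vert3; simpl. lra.
  - destruct (HT n) as [H _]. simpl. assert (0 < 4 ^ n) by (apply pow_lt; lra). nra. }
destruct (Cseq_limit (fun n => vert1 (T n)) L) as [p Hp].
{ intros n. destruct (HT n) as [_ [_ H]]. specialize (Hper n). lra. }
assert (Hsmall : forall eps, 0 < eps -> exists n, L / 2 ^ n < eps).
{ intros eps Heps. destruct (pow_lt_1_zero (/ 2) ltac:(rewrite Rabs_pos_eq; lra) (eps / (L + 1))) as [N HN].
  { apply Rdiv_lt_0_compat; lra. }
  exists N. specialize (HN N (le_n N)). rewrite pow_inv in HN.
  assert (Hpow : 0 < / 2 ^ N) by (apply Rinv_0_lt_compat, pow_lt; lra).
  rewrite Rabs_pos_eq in HN by lra.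
  apply Rle_lt_trans with ((L + 1) * / 2 ^ N). { unfold Rdiv. nra. }
  apply (Rmult_lt_compat_l (L + 1)) in HN; [|lra].
  replace ((L + 1) * (eps / (L + 1))) with eps in HN by (field; lra). exact HN. }
assert (Dp : D p).
{ apply D_closed. intros eps Heps. destruct (Hsmall (eps / 2)) as [n Hn]; [lra|].
  exists (vert1 (T n)). split.
  - exact (proj1 (proj2_sig (T n))).
  - specialize (Hp n). simpl in Hp. lra. }
destruct (f_diff p Dp) as [l Hl].
apply Cmod_eq_0, Rle_antisym; [|apply Cmod_ge_0].
assert (Main : forall eps, 0 < eps -> Cmod (Ctri f a b c) <= eps * (3 * L * L)).
{ intros eps Heps. destruct (Hl eps Heps) as [d [Hd1 Hd2]].
  destruct (Hsmall (d / 3)) as [n Hn]; [lra|].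
  specialize (Hp n). simpl in Hp. specialize (Hper n). specialize (Hint n).
  assert (HDn := proj2_sig (T n)).
  unfold tri_per in Hper. unfold tri_int in Hint.
  change (D (vert1 (T n)) /\ D (vert2 (T n)) /\ D (vert3 (T n))) in HDn.
  set (a' := vert1 (T n)) in *. set (b' := vert2 (T n)) in *. set (c' := vert3 (T n)) in *.
  destruct HDn as [Ha' [Hb' Hc']].
  set (q := L / 2 ^ n) in *.
  set (aff := fun z : C => (f p + l * (z - p))%C).
  assert (E : Ctri f a' b' c' = Ctri (fun z => f z - aff z)%C a' b' c').
  { assert (Z := Ctri_affine (f p) l p a' b' c'). fold aff in Z.
    assert (HA : forall x y, cont_on_seg aff x y) by (intros x y t _; eapply cderiv_ccont, cderiv_affine).
    unfold Ctri in Z |- *.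
    rewrite !Cint_seg_minus by (auto; now apply convex_cont_on_seg).
    transitivity (Cint_seg f a' b' + Cint_seg f b' c' + Cint_seg f c' a' - 0)%C; [ring|].
    rewrite <- Z. ring. }
  assert (B : Cmod (Ctri f a' b' c') <= perimeter a' b' c' * (eps * (3 * q))).
  { assert (HC : forall x y, D x -> D y -> cont_on_seg (fun z => f z - aff z)%C x y).
    { intros x y Hx Hy t Ht.
      assert (Dz : D (x + t * (y - x))%C) by now apply D_convex.
      destruct (f_diff _ Dz) as [l' Hl'].
      apply (cderiv_ccont _ _ (l' - l)%C), cderiv_minus; [exact Hl' | apply cderiv_affine]. }
    rewrite E. apply Ctri_bound; auto.
    intros z Hz.
    (* At most [q] from [z] to the first vertex, by the perimeter, and [2 * q] from there to [p]. *)
    assert (Hzp : Cmod (z - p) <= 3 * q).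
    { replace (z - p)%C with ((z - a') + (a' - p))%C by ring.
      apply Rle_trans with (1 := Cmod_triangle _ _). lra. }
    unfold aff. replace (f z - (f p + l * (z - p)))%C with (f z - f p - l * (z - p))%C by ring.
    apply Rle_trans with (eps * Cmod (z - p)).
    - apply Hd2. lra.
    - apply Rmult_le_compat_l; lra. }
  assert (Hq0 : 0 <= q). { apply Rdiv_le_0_compat; auto. apply pow_lt; lra. }
  assert (H4 : 0 < 4 ^ n) by (apply pow_lt; lra).
  apply Rle_trans with (1 := Hint).
  apply Rle_trans with (4 ^ n * (q * (eps * (3 * q)))).
  { apply Rmult_le_compat_l; [lra|]. apply Rle_trans with (1 := B).
    apply Rmult_le_compat_r; [|exact Hper]. apply Rmult_le_pos; lra. }
  right. unfold q. replace (4 ^ n) with (2 ^ n * 2 ^ n) by (rewrite <- Rpow_mult_distr; f_equal; lra).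
  field. apply pow_nonzero; lra. }
apply le_epsilon. intros eps Heps.
apply Rle_trans with (1 := Main (eps / (3 * L * L + 1)) ltac:(apply Rdiv_lt_0_compat; nra)).
rewrite Rplus_0_l.
apply (Rmult_le_reg_r (3 * L * L + 1)); [nra|].
replace (eps / (3 * L * L + 1) * (3 * L * L) * (3 * L * L + 1)) with (eps * (3 * L * L)) by (field; nra).
nra.
Qed.

End Goursat.

(** * Primitives on the disc *)

Definition cdiff (f : C -> C) (z : C) : Prop := exists l, cderiv f z l.

Lemma cdiff_ccont (f : C -> C) (z : C) : cdiff f z -> ccont f z.
Proof. intros [l H]. exact (cderiv_ccont _ _ _ H). Qed.

Lemma analytic_cdiff (f : C -> C) :
  analytic f <-> forall z, in_disc z -> cdiff f z.
Proof. split; intros H z Hz; now apply ex_derive_cderiv, H. Qed.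

Lemma cdiff_plus (f g : C -> C) (z : C) :
  cdiff f z -> cdiff g z -> cdiff (fun u => f u + g u)%C z.
Proof. intros [l Hl] [m Hm]. eexists. now apply cderiv_plus; eassumption. Qed.

Lemma cdiff_minus (f g : C -> C) (z : C) :
  cdiff f z -> cdiff g z -> cdiff (fun u => f u - g u)%C z.
Proof. intros [l Hl] [m Hm]. eexists. now apply cderiv_minus; eassumption. Qed.

Lemma cdiff_mult (f g : C -> C) (z : C) :
  cdiff f z -> cdiff g z -> cdiff (fun u => f u * g u)%C z.
Proof. intros [l Hl] [m Hm]. eexists. now apply cderiv_mult; eassumption. Qed.

Lemma cdiff_const (c z : C) : cdiff (fun _ => c) z.
Proof. eexists. apply cderiv_const. Qed.

Lemma cdiff_id (z : C) : cdiff (fun u => u) z.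
Proof. eexists. apply cderiv_id. Qed.

Lemma cdiff_inv (f : C -> C) (z : C) :
  cdiff f z -> f z <> 0%C -> cdiff (fun u => / f u)%C z.
Proof.
intros [l Hl] Hz. eexists. eapply (cderiv_comp f Cinv); [exact Hl|]. now apply cderiv_inv.
Qed.

Lemma cdiff_comp (f g : C -> C) (z : C) :
  cdiff f z -> cdiff g (f z) -> cdiff (fun u => g (f u)) z.
Proof. intros [l Hl] [m Hm]. eexists. now apply (cderiv_comp f g); eassumption. Qed.

Lemma cdiff_comp_affine (f : C -> C) (a b z : C) :
  cdiff f (a + b * z)%C -> cdiff (fun u => f (a + b * u)%C) z.
Proof.
intros H. apply (cdiff_comp (fun u => a + b * u)%C f); [|exact H].
apply (cdiff_plus (fun _ => a)); [apply cdiff_const|].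
apply (cdiff_mult (fun _ => b)); [apply cdiff_const | apply cdiff_id].
Qed.

Lemma Cmod_convex (a b : C) (t r : R) :
  0 <= t <= 1 -> Cmod a <= r -> Cmod b <= r -> Cmod (a + t * (b - a))%C <= r.
Proof.
intros Ht Ha Hb.
replace (a + t * (b - a))%C with ((1 - t)%R * a + t * b)%C by (rewrite RtoC_minus; ring).
apply Rle_trans with (1 := Cmod_triangle _ _). rewrite !Cmod_scal_R by lra. nra.
Qed.

Lemma convex_closed_ball (r : R) : convex (fun z => Cmod z <= r).
Proof. intros a b t Ha Hb Ht. now apply Cmod_convex. Qed.

Lemma adherence_closed_ball (r : R) : adherence_closed (fun z => Cmod z <= r).
Proof.
intros p Hp. apply le_epsilon. intros eps Heps.
destruct (Hp eps Heps) as [q [Hq Hd]].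
replace p with (q + - (q - p))%C by ring.
apply Rle_trans with (1 := Cmod_triangle _ _). rewrite Cmod_opp. lra.
Qed.

(** Goursat on the triangle [0, z, u] turns the increment of the primitive into the integral of [h]
    over the segment from [z] to [u], where [h] is within [eps] of [h z]. *)
Theorem cderiv_primitive (h : C -> C) (z : C) :
  (forall u, in_disc u -> cdiff h u) -> in_disc z ->
  cderiv (Cint_seg h 0) z (h z).
Proof.
intros Hh Hz eps Heps. unfold in_disc in Hz.
assert (Hz0 := Cmod_ge_0 z).
(* The closed disc of this radius is a closed convex set inside the unit disc with [z] in its
   interior. *)
set (rho := (1 + Cmod z) / 2).
assert (HD : forall u, Cmod u <= rho -> cdiff h u) by (intros u Hu; apply Hh; unfold in_disc, rho in *; lra).
assert (HC : forall u, Cmod u <= rho -> ccont h u) by (intros u Hu; apply cdiff_ccont, HD, Hu).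
destruct (cdiff_ccont h z (Hh z Hz) eps Heps) as [d [Hd1 Hd2]].
exists (Rmin d (rho - Cmod z)). split. { apply Rmin_glb_lt; unfold rho; lra. }
intros u Hu.
assert (Hu1 := Rlt_le_trans _ _ _ Hu (Rmin_l _ _)).
assert (Hu2 := Rlt_le_trans _ _ _ Hu (Rmin_r _ _)).
assert (Bz : Cmod z <= rho) by (unfold rho; lra).
assert (Bu : Cmod u <= rho).
{ replace u with ((u - z) + z)%C by ring. apply Rle_trans with (1 := Cmod_triangle _ _). lra. }
assert (B0 : Cmod 0 <= rho) by (rewrite Cmod_0; unfold rho; lra).
assert (G := goursat h (fun z => Cmod z <= rho) (convex_closed_ball rho) HC 0%C z u
  (adherence_closed_ball rho) HD B0 Bz Bu).
assert (HS : forall x y, Cmod x <= rho -> Cmod y <= rho -> cont_on_seg h x y).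
{ intros x y Hx Hy. exact (convex_cont_on_seg h (fun z => Cmod z <= rho) (convex_closed_ball rho) HC x y Hx Hy). }
unfold Ctri in G. rewrite (Cint_seg_swap h 0 u) in G by auto.
replace (Cint_seg h 0 u - Cint_seg h 0 z - h z * (u - z))%C
  with (Cint_seg (fun x => h x - h z)%C z u).
2: { rewrite (Cint_seg_minus h (fun _ => h z)) by (auto; intros t _; apply cdiff_ccont, cdiff_const).
     rewrite Cint_seg_const.
     transitivity ((Cint_seg h 0 z + Cint_seg h z u + - Cint_seg h 0 u) + Cint_seg h 0 u - Cint_seg h 0 z - (u - z) * h z)%C; [ring|].
     rewrite G. ring. }
rewrite Rmult_comm. apply Cint_seg_bound.
- intros t Ht. apply cdiff_ccont, cdiff_minus; [|apply cdiff_const].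
  apply HD, Cmod_convex; auto.
- intros t Ht. left. apply Hd2.
  replace (z + t * (u - z) - z)%C with (t * (u - z))%C by ring.
  rewrite Cmod_scal_R by lra. assert (Hr := Cmod_ge_0 (u - z)). nra.
Qed.

(** * Rotation by [i] and the four-fold sum *)

Lemma Cmod_Ci : Cmod Ci = 1.
Proof. unfold Cmod, Ci; simpl. replace (0 * (0 * 1) + 1 * (1 * 1)) with 1 by ring. apply sqrt_1. Qed.

Lemma Ci2 : (Ci * Ci = -1)%C.
Proof. unfold Ci, Cmult, Copp, RtoC; simpl. f_equal; ring. Qed.

(** Rotation multiplies [dx] by [i] and [e] by [-i], so [e dx] is invariant. *)
Lemma Cint_seg_rotate (e : C -> C) (a b : C) :
  cont_on_seg e a b ->
  (forall t : R, 0 <= t <= 1 ->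
    e (Ci * (a + t * (b - a)))%C = (- Ci * e (a + t * (b - a)))%C) ->
  Cint_seg e (Ci * a) (Ci * b) = Cint_seg e a b.
Proof.
intros Hc He. unfold Cint_seg.
rewrite (CRInt_ext _ (fun t : R => - Ci * e (a + t * (b - a)))%C).
- rewrite CRInt_Cmult by now apply ex_CRInt_seg.
  transitivity (- (Ci * Ci) * ((b - a) * CRInt (fun t : R => e (a + t * (b - a))%C) 0 1))%C; [ring|].
  rewrite Ci2. ring.
- intros t Ht. rewrite <- He by assumption. f_equal. ring.
Qed.

(* The sum over the four rotations by [i] extracts [4 F'(z) / x] from [F (z + i^k x) / x^2]
   near [x = 0] and makes [four_fold F z x dx] invariant under [x -> i x]. *)
Definition four_fold (F : C -> C) (z x : C) : C :=
  ((F (z + 1 * x) + - Ci * F (z + Ci * x) + (-1) * F (z + (-1) * x) + Ci * F (z + - Ci * x))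
   * / (x * x))%C.

(** Replacing [x] by [i x] permutes the four values cyclically, which multiplies the numerator by
    [i], and changes the sign of [x^2]. *)
Lemma four_fold_rotate (F : C -> C) (z x : C) : x <> 0%C ->
  four_fold F z (Ci * x) = (- Ci * four_fold F z x)%C.
Proof.
intros Hx. unfold four_fold.
replace (1 * (Ci * x))%C with (Ci * x)%C by ring.
replace (Ci * (Ci * x))%C with (-1 * x)%C by (rewrite Cmult_assoc, Ci2; ring).
replace (-1 * (Ci * x))%C with (- Ci * x)%C by ring.
replace (- Ci * (Ci * x))%C with (1 * x)%C.
2: { transitivity (- (Ci * Ci) * x)%C; [rewrite Ci2; ring | ring]. }
replace (Ci * x * (Ci * x))%C with (- (x * x))%C.
2: { transitivity ((Ci * Ci) * (x * x))%C; [rewrite Ci2; ring | ring]. }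
replace (/ - (x * x))%C with (- / (x * x))%C by (field; exact Hx).
set (A := F (z + 1 * x)%C). set (B := F (z + Ci * x)%C).
set (E := F (z + -1 * x)%C). set (G := F (z + - Ci * x)%C). set (y := (/ (x * x))%C).
transitivity ((- Ci * A + (-1) * B + Ci * E + 1 * G) * y)%C; [ring|].
(* [ring] treats [Ci] as an atom, so the relation [Ci * Ci = -1] is inserted explicitly. *)
transitivity ((- Ci * A + (Ci * Ci) * B + Ci * E + - (Ci * Ci) * G) * y)%C; [rewrite Ci2; ring | ring].
Qed.

(** * Cauchy's estimate *)

Lemma Cmod_m1 : Cmod (-1) = 1.
Proof. rewrite Cmod_R, Rabs_left; lra. Qed.

Lemma four_fold_le (A B E G : C) (m : R) :
  Cmod A <= m -> Cmod B <= m -> Cmod E <= m -> Cmod G <= m ->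
  Cmod (A + - Ci * B + (-1) * E + Ci * G) <= 4 * m.
Proof.
intros HA HB HE HG.
apply Rle_trans with (1 := Cmod_triangle _ _).
apply Rle_trans with (1 := Rplus_le_compat_r _ _ _ (Cmod_triangle _ _)).
apply Rle_trans with (1 := Rplus_le_compat_r _ _ _ (Rplus_le_compat_r _ _ _ (Cmod_triangle _ _))).
rewrite !Cmod_mult, Cmod_m1, Cmod_opp, Cmod_Ci. lra.
Qed.

Lemma fst_seg (a b : C) (t : R) : fst (a + t * (b - a))%C = fst a + t * (fst b - fst a).
Proof. simpl. ring. Qed.

Section Cauchy.
Variables (F : C -> C) (z l : C) (s M : R).
Hypothesis s_pos : 0 < s.
Hypothesis F_diff : forall u, Cmod (u - z) <= 2 * s -> cdiff F u.
Hypothesis F_le : forall u, Cmod (u - z) <= 2 * s -> Cmod (F u) <= M.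
Hypothesis F_deriv : cderiv F z l.

(** The right-hand side of the square of half-side [r] centred at [0] runs from [corner r] up to
    [Ci * corner r]. For [r > 0] the cap [half_disc r] is a closed convex set missing [0]; it
    contains this side and the corresponding side for [s] when [r <= s]. *)
Let corner (r : R) : C := (r, - r).
Let half_disc (r : R) (x : C) : Prop := r <= fst x /\ Cmod x <= 2 * s.

Lemma half_disc_convex (r : R) : convex (half_disc r).
Proof.
intros a b t [Ha1 Ha2] [Hb1 Hb2] Ht. split.
- rewrite fst_seg. nra.
- now apply Cmod_convex.
Qed.

Lemma half_disc_closed (r : R) : adherence_closed (half_disc r).
Proof.
intros p Hp. split.
- apply le_epsilon. intros eps Heps. destruct (Hp eps Heps) as [q [[Hq _] Hd]].
  assert (K := re_le_Cmod (q - p)).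
  assert (K2 : Re (q - p)%C = fst q - fst p) by (unfold Re; simpl; ring).
  rewrite K2 in K. assert (K3 := Rle_abs (fst q - fst p)). lra.
- apply adherence_closed_ball. intros eps Heps. destruct (Hp eps Heps) as [q [[_ Hq] Hd]].
  now exists q.
Qed.

Lemma half_disc_neq0 (r : R) (x : C) : 0 < r -> half_disc r x -> x <> 0%C.
Proof. intros Hr [H _] E. rewrite E in H. simpl in H. lra. Qed.

Lemma four_fold_cdiff (r : R) (x : C) : 0 < r -> half_disc r x -> cdiff (four_fold F z) x.
Proof.
intros Hr Hx. assert (H0 := half_disc_neq0 r x Hr Hx). destruct Hx as [_ Hx].
assert (HB : forall B, Cmod B = 1 -> cdiff (fun u => F (z + B * u)%C) x).
{ intros B HB. apply cdiff_comp_affine, F_diff.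
  replace (z + B * x - z)%C with (B * x)%C by ring. rewrite Cmod_mult, HB. lra. }
assert (Hm := Cmod_m1).
assert (Hi : Cmod (- Ci) = 1) by (rewrite Cmod_opp; apply Cmod_Ci).
apply cdiff_mult.
- repeat apply cdiff_plus.
  + apply HB, Cmod_1.
  + apply cdiff_mult; [apply cdiff_const|]. apply HB, Cmod_Ci.
  + apply cdiff_mult; [apply cdiff_const|]. apply HB, Hm.
  + apply cdiff_mult; [apply cdiff_const|]. apply HB, Hi.
- apply (cdiff_inv (fun u => u * u)%C).
  + apply cdiff_mult; apply cdiff_id.
  + now apply Cmult_neq_0.
Qed.

Lemma corner_mod (r : R) : 0 < r -> Cmod (corner r) <= 2 * r.
Proof.
intros Hr. unfold Cmod, corner; simpl.
apply Rle_trans with (sqrt ((2 * r) * (2 * r))); [apply sqrt_le_1_alt; nra|].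
rewrite sqrt_square; lra.
Qed.

Lemma Ci_corner (r : R) : (Ci * corner r)%C = (r, r).
Proof. unfold Ci, corner, Cmult; simpl. f_equal; ring. Qed.

Lemma half_disc_corner (r x : R) : 0 < x -> r <= x <= s ->
  half_disc r (corner x) /\ half_disc r (Ci * corner x)%C.
Proof.
intros H0 Hx. assert (K := corner_mod x H0). split; split.
- simpl; lra.
- lra.
- rewrite Ci_corner. simpl. lra.
- rewrite Cmod_mult, Cmod_Ci. lra.
Qed.

(** The two sides are the parallel edges of a trapezoid, which a diagonal cuts into two triangles to
    which Goursat applies. The slanted edges are exchanged by rotation by [i], so their integrals
    agree and cancel. *)
Lemma four_fold_side (r : R) : 0 < r < s ->
  Cint_seg (four_fold F z) (corner s) (Ci * corner s)
  = Cint_seg (four_fold F z) (corner r) (Ci * corner r).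
Proof.
intros Hr. set (e := four_fold F z).
assert (HD : forall x, half_disc r x -> cdiff e x) by (intros x; apply four_fold_cdiff; lra).
assert (HC : forall x, half_disc r x -> ccont e x) by (intros x Hx; now apply cdiff_ccont, HD).
destruct (half_disc_corner r r) as [Dr Dir]; try lra.
destruct (half_disc_corner r s) as [Ds Dis]; try lra.
assert (HS : forall x y, half_disc r x -> half_disc r y -> cont_on_seg e x y).
{ intros x y. apply convex_cont_on_seg; [apply half_disc_convex | exact HC]. }
assert (G : forall x y w, half_disc r x -> half_disc r y -> half_disc r w -> Ctri e x y w = 0%C).
{ intros x y w. apply goursat; auto; [apply half_disc_convex | apply half_disc_closed]. }
assert (G1 := G (corner r) (corner s) (Ci * corner s)%C Dr Ds Dis).
assert (G2 := G (corner r) (Ci * corner s)%C (Ci * corner r)%C Dr Dis Dir).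
assert (Rot : Cint_seg e (Ci * corner r) (Ci * corner s) = Cint_seg e (corner r) (corner s)).
{ apply Cint_seg_rotate; auto. intros t Ht. apply four_fold_rotate.
  apply (half_disc_neq0 r); [lra|]. now apply half_disc_convex. }
unfold Ctri in G1, G2.
rewrite (Cint_seg_swap e (corner r) (Ci * corner s)) in G1 by auto.
rewrite (Cint_seg_swap e (Ci * corner r) (Ci * corner s)) in G2 by auto.
rewrite (Cint_seg_swap e (corner r) (Ci * corner r)) in G2 by auto.
rewrite Rot in G2.
assert (K := f_equal2 Cplus G1 G2).
match type of K with (?x = _)%C => transitivity (x + Cint_seg e (corner r) (Ci * corner r))%C; [ring|] end.
rewrite K. ring.
Qed.

(** The side has length [2 * s]; on it [|x| >= s], and four values of modulus at most [M] are
    added. *)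
Lemma four_fold_far_side : Cmod (Cint_seg (four_fold F z) (corner s) (Ci * corner s)) <= 8 * M / s.
Proof.
destruct (half_disc_corner s s) as [Ds Dis]; try lra.
replace (8 * M / s) with (2 * s * (4 * M / (s * s))) by (field; lra).
replace (2 * s) with (Cmod (Ci * corner s - corner s)).
2: { rewrite Ci_corner. unfold corner.
     replace (Cminus (s, s) (s, - s)) with (Ci * (2 * s)%R)%C.
     - rewrite Cmod_mult, Cmod_Ci, Cmod_R, Rabs_pos_eq by lra. ring.
     - unfold Ci, RtoC, Cmult, Cminus, Cplus, Copp; simpl. f_equal; ring. }
apply Cint_seg_bound.
- apply (convex_cont_on_seg _ (half_disc s)); auto; [apply half_disc_convex|].
  intros x Hx. now apply cdiff_ccont, (four_fold_cdiff s).
- intros t Ht.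
  assert (Hx := half_disc_convex s _ _ t Ds Dis Ht).
  set (x := (corner s + t * (Ci * corner s - corner s))%C) in *.
  assert (Hx0 := half_disc_neq0 s x s_pos Hx). destruct Hx as [Hx1 Hx2].
  assert (Hxs : s <= Cmod x).
  { apply Rle_trans with (1 := Hx1). apply Rle_trans with (1 := Rle_abs _). apply re_le_Cmod. }
  unfold four_fold. rewrite Cmod_mult, Cmod_inv, Cmod_mult by now apply Cmult_neq_0.
  assert (HB : forall B, Cmod B = 1 -> Cmod (F (z + B * x)%C) <= M).
  { intros B HB. apply F_le. replace (z + B * x - z)%C with (B * x)%C by ring.
    rewrite Cmod_mult, HB. lra. }
  unfold Rdiv. apply Rmult_le_compat.
  + apply Cmod_ge_0.
  + left. apply Rinv_0_lt_compat. nra.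
  + apply four_fold_le; apply HB.
    * apply Cmod_1.
    * apply Cmod_Ci.
    * apply Cmod_m1.
    * rewrite Cmod_opp. apply Cmod_Ci.
  + apply Rinv_le_contravar; nra.
Qed.

(** The coefficients [1, -i, -1, i] sum to zero, which removes [F z]; multiplied by the matching
    rotations [1, i, -1, -i] they each give [1], so the linear part contributes [4 l x / x^2]. *)
Lemma four_fold_near (eps : R) (x : C) : 0 < eps ->
  x <> 0%C ->
  (forall u, Cmod (u - z) <= Cmod x -> Cmod (F u - F z - l * (u - z)) <= eps * Cmod (u - z)) ->
  Cmod (four_fold F z x - 4 * l / x) <= 4 * eps / Cmod x.
Proof.
intros He Hx H.
assert (HB : forall B, Cmod B = 1 -> Cmod (F (z + B * x) - F z - l * (B * x))%C <= eps * Cmod x).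
{ intros B HB. specialize (H (z + B * x)%C).
  replace (z + B * x - z)%C with (B * x)%C in H by ring.
  rewrite Cmod_mult, HB, Rmult_1_l in H. apply H. lra. }
assert (Hp := proj1 (Cmod_gt_0 x) Hx).
replace (four_fold F z x - 4 * l / x)%C with
  (((F (z + 1 * x) - F z - l * (1 * x)) + - Ci * (F (z + Ci * x) - F z - l * (Ci * x))
    + (-1) * (F (z + (-1) * x) - F z - l * ((-1) * x)) + Ci * (F (z + - Ci * x) - F z - l * (- Ci * x)))
   * / (x * x))%C.
- rewrite Cmod_mult, Cmod_inv, Cmod_mult by now apply Cmult_neq_0.
  replace (4 * eps / Cmod x) with (4 * (eps * Cmod x) * / (Cmod x * Cmod x)) by (field; lra).
  apply Rmult_le_compat_r. { left. apply Rinv_0_lt_compat. nra. }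
  apply four_fold_le; apply HB.
  + apply Cmod_1.
  + apply Cmod_Ci.
  + apply Cmod_m1.
  + rewrite Cmod_opp. apply Cmod_Ci.
- unfold four_fold.
  set (A := F (z + 1 * x)%C). set (B := F (z + Ci * x)%C).
  set (E := F (z + -1 * x)%C). set (G := F (z + - Ci * x)%C).
  replace (4 * l / x)%C with (4 * l * x * / (x * x))%C by (field; auto).
  transitivity ((A + - Ci * B + -1 * E + Ci * G - (2 - (Ci * Ci) * 2) * l * x) * / (x * x))%C; [ring|].
  rewrite Ci2. ring.
Qed.

(** The integral of [4 l / x] over the near side is exactly [2 pi i l]. Comparing the integrand with
    the constant [6 i l] instead leaves an error of at most [5 |l|], hence still a lower bound [|l|]
    for the integral, which the far side bounds above by [8 M / s]. *)
Theorem cauchy_estimate : Cmod l <= 8 * M / s.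
Proof.
apply le_epsilon. intros eps Heps.
destruct (F_deriv (eps / 8)) as [d [Hd1 Hd2]]; [lra|].
(* Half of [s] keeps [r < s]; a third of [d] gives [|x| <= 2 r < d] along the near side. *)
set (r := Rmin (s / 2) (d / 3)).
assert (Hr0 : 0 < r) by (unfold r; apply Rmin_glb_lt; lra).
assert (Hr1 : r <= s / 2) by apply Rmin_l.
assert (Hr2 : r <= d / 3) by apply Rmin_r.
destruct (half_disc_corner r r) as [Dr Dir]; try lra.
assert (HI := four_fold_far_side). rewrite (four_fold_side r) in HI by lra.
set (I := Cint_seg (four_fold F z) (corner r) (Ci * corner r)) in *.
assert (HS : cont_on_seg (four_fold F z) (corner r) (Ci * corner r)).
{ apply (convex_cont_on_seg _ (half_disc r)); auto; [apply half_disc_convex|].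
  intros x Hx. now apply cdiff_ccont, (four_fold_cdiff r). }
assert (Hex := ex_CRInt_seg _ _ _ HS).
set (D := (Ci * corner r - corner r)%C).
assert (ED : D = (Ci * (2 * r)%R)%C).
{ unfold D. rewrite Ci_corner. unfold corner, Ci, RtoC, Cmult, Cminus, Cplus, Copp; simpl. f_equal; ring. }
assert (HD : Cmod D = 2 * r).
{ rewrite ED, Cmod_mult, Cmod_Ci, Cmod_R, Rabs_pos_eq by lra. ring. }
(* [4 l / x dx = 8 i l / (1 + i y) dy] on the near side, and [|1/(1 + i y) - 3/4| <= 5/8]. *)
assert (Hnear : Cmod (I - 6 * (Ci * l)) <= 5 * Cmod l + eps).
{ set (e := fun t : R => four_fold F z (corner r + t * (Ci * corner r - corner r))%C) in *.
  replace (I - 6 * (Ci * l))%C with (CRInt (fun t => D * e t - 6 * (Ci * l))%C 0 1).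
  2: { rewrite CRInt_minus, CRInt_const, CRInt_Cmult; [reflexivity|exact Hex| |].
       - eexists. apply is_CRInt_Cmult. exact (RInt_correct (V := C_R_CompleteNormedModule) _ _ _ Hex).
       - apply (ex_RInt_const (V := C_R_CompleteNormedModule)). }
  apply CRInt_le_const.
  { apply (ex_RInt_minus (V := C_R_CompleteNormedModule) (fun t => D * e t)%C (fun _ => 6 * (Ci * l))%C).
    - eexists. apply is_CRInt_Cmult. exact (RInt_correct (V := C_R_CompleteNormedModule) _ _ _ Hex).
    - apply (ex_RInt_const (V := C_R_CompleteNormedModule)). }
  intros t Ht. unfold e.
  assert (Hx := half_disc_convex r _ _ t Dr Dir Ht).
  set (x := (corner r + t * (Ci * corner r - corner r))%C) in *.
  assert (Hx0 := half_disc_neq0 r x Hr0 Hx).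
  assert (Hxr : r <= Cmod x).
  { destruct Hx as [Hx _]. apply Rle_trans with (1 := Hx). apply Rle_trans with (1 := Rle_abs _). apply re_le_Cmod. }
  assert (Hx2 : Cmod x <= 2 * r).
  { apply Cmod_convex; auto; [apply corner_mod, Hr0|].
    rewrite Cmod_mult, Cmod_Ci. assert (K := corner_mod r Hr0). lra. }
  assert (Hn : Cmod (four_fold F z x - 4 * l / x) <= 4 * (eps / 8) / Cmod x).
  { apply four_fold_near; [lra | exact Hx0 |]. intros u Hu. apply Hd2. lra. }
  replace (D * four_fold F z x - 6 * (Ci * l))%C
    with ((D * 4 * l / x - 6 * (Ci * l)) + D * (four_fold F z x - 4 * l / x))%C by (field; auto).
  apply Rle_trans with (1 := Cmod_triangle _ _).
  apply Rplus_le_compat.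
  - set (y := (2 * t - 1)%R).
    assert (Ex : x = (r * (1 + Ci * y))%C).
    { unfold x. rewrite Ci_corner. unfold corner, y, Ci, RtoC, Cmult, Cminus, Cplus, Copp; simpl. f_equal; ring. }
    assert (Hy0 : (1 + Ci * y)%C <> 0%C).
    { intros E. apply Hx0. rewrite Ex, E. ring. }
    assert (Hrc : RtoC r <> 0%C).
    { intros E. apply Hx0. rewrite Ex, E. ring. }
    replace (D * 4 * l / x - 6 * (Ci * l))%C with (2 * (Ci * l) * ((1 - Ci * (3 * y)%R) / (1 + Ci * y)))%C.
    2: { rewrite Ex, ED, !RtoC_mult. field. split; assumption. }
    rewrite !Cmod_mult, Cmod_div, Cmod_Ci, Cmod_R, Rabs_pos_eq by (auto; lra).
    (* After squaring: [1 + 9 y^2 <= 25/4 (1 + y^2)], true because [y^2 <= 1]. *)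
    assert (Hy : Cmod (1 - Ci * (3 * y)%R) <= 5 / 2 * Cmod (1 + Ci * y)).
    { unfold Cmod, Ci, RtoC, Cmult, Cminus, Cplus, Copp; simpl.
      rewrite <- (sqrt_square (5 / 2)) by lra. rewrite <- sqrt_mult_alt by lra.
      apply sqrt_le_1_alt. assert (Hy : -1 <= y <= 1) by (unfold y; lra).
      assert (y * y <= 1) by nra. nra. }
    apply Cmod_gt_0 in Hy0.
    apply Rle_trans with (2 * (1 * Cmod l) * (5 / 2)); [|right; field].
    apply Rmult_le_compat_l. { assert (K := Cmod_ge_0 l). lra. }
    apply (Rmult_le_reg_r (Cmod (1 + Ci * y))); [exact Hy0|].
    unfold Rdiv at 1. rewrite Rmult_assoc, Rinv_l, Rmult_1_r by lra. exact Hy.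
  - rewrite Cmod_mult, HD.
    apply Rle_trans with (2 * r * (4 * (eps / 8) / r)); [|right; field; lra].
    apply Rmult_le_compat_l; [lra|]. apply Rle_trans with (1 := Hn).
    unfold Rdiv. apply Rmult_le_compat_l; [lra|]. apply Rinv_le_contravar; lra. }
assert (H6 : Cmod (6 * (Ci * l)) = 6 * Cmod l).
{ rewrite !Cmod_mult, Cmod_Ci, Cmod_R, Rabs_pos_eq by lra. ring. }
assert (T := Cmod_triangle I (- (I - 6 * (Ci * l)))).
replace (I + - (I - 6 * (Ci * l)))%C with (6 * (Ci * l))%C in T by ring.
rewrite H6, Cmod_opp in T. lra.
Qed.

End Cauchy.

(** * Weights *)

(** The eventual monotonicity becomes a comparison on all of [[0,1)] at the cost of a constant, [v]
    being between [v r0] and [v 0] before [r0]. Enlarging the exponent to an integer is harmless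
    since [(1 - r) / (1 - s) <= 1], and makes ordinary powers usable later. *)
Lemma weight_le_pow (v : R -> R) : weight v ->
  (exists alpha r0 : R, 0 < alpha /\ 0 < r0 < 1 /\
     increasing_from r0 (fun r => v r * Rpower (1 - r) (- alpha))) ->
  exists (c : R) (m : nat), 0 < c /\
    forall s r, 0 <= s -> s <= r -> r < 1 -> v s * (1 - r) ^ m <= c * v r * (1 - s) ^ m.
Proof.
intros [Hpos [_ Hmon]] [alpha [r0 [Ha [Hr0 Hinc]]]].
destruct (INR_unbounded alpha) as [m Hm].
assert (Hv0 := Hpos 0 ltac:(lra)). assert (Hvr0 := Hpos r0 ltac:(lra)).
assert (Hv0r0 := Hmon 0 r0 ltac:(lra) ltac:(lra) ltac:(lra)).
assert (Hbig : forall s r, r0 <= s -> s <= r -> r < 1 -> v s * (1 - r) ^ m <= v r * (1 - s) ^ m).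
{ intros s r Hs Hsr Hr.
  assert (H := Hinc s r Hs Hsr Hr). simpl in H.
  assert (Hvr := Hpos r ltac:(lra)).
  rewrite <- !Rpower_pow by lra.
  replace (INR m) with (alpha + (INR m - alpha)) by ring. rewrite !Rpower_plus.
  assert (HA : Rpower (1 - s) (- alpha) * Rpower (1 - s) alpha = 1).
  { rewrite <- Rpower_plus. replace (- alpha + alpha) with 0 by ring. apply Rpower_O. lra. }
  assert (HB : Rpower (1 - r) (- alpha) * Rpower (1 - r) alpha = 1).
  { rewrite <- Rpower_plus. replace (- alpha + alpha) with 0 by ring. apply Rpower_O. lra. }
  assert (HC := Rle_Rpower_l (1 - r) (1 - s) (INR m - alpha) ltac:(lra) ltac:(lra)).
  assert (P : forall x y, 0 < Rpower x y) by (intros; apply exp_pos).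
  assert (PA := P (1 - s) alpha). assert (PB := P (1 - r) alpha).
  assert (PC := P (1 - r) (INR m - alpha)).
  set (A := Rpower (1 - s) alpha) in *. set (B := Rpower (1 - r) alpha) in *.
  set (A' := Rpower (1 - s) (- alpha)) in *. set (B' := Rpower (1 - r) (- alpha)) in *.
  assert (H2 : v s * B <= v r * A).
  { apply (Rmult_le_compat_r (A * B)) in H; [|nra].
    replace (v s * A' * (A * B)) with (v s * B * (A' * A)) in H by ring.
    replace (v r * B' * (A * B)) with (v r * A * (B' * B)) in H by ring.
    rewrite HA, HB in H. lra. }
  rewrite <- !Rmult_assoc. apply Rmult_le_compat; try lra.
  - apply Rmult_le_pos; [|lra]. left. apply Hpos; lra. }
set (c := v 0 / v r0).
assert (Hc : 1 <= c).
{ unfold c. apply (Rmult_le_reg_r (v r0)); auto. unfold Rdiv. rewrite Rmult_assoc, Rinv_l; lra. }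
assert (Ec : v 0 = c * v r0) by (unfold c; field; lra).
exists c, m. split; [lra|]. intros s r Hs Hsr Hr.
assert (Hvs := Hpos s ltac:(lra)). assert (Hvr := Hpos r ltac:(lra)).
assert (Hpr : 0 <= (1 - r) ^ m) by (apply pow_le; lra).
assert (Hprs : (1 - r) ^ m <= (1 - s) ^ m) by (apply pow_incr; lra).
destruct (Rle_lt_dec r0 s) as [H|H].
- specialize (Hbig s r H Hsr Hr). assert (0 <= v r * (1 - s) ^ m) by (apply Rmult_le_pos; lra). nra.
- assert (Hvs0 := Hmon 0 s ltac:(lra) ltac:(lra) ltac:(lra)).
  destruct (Rle_lt_dec r0 r) as [H'|H'].
  + specialize (Hbig r0 r ltac:(lra) H' Hr).
    assert (Hp0 : (1 - r0) ^ m <= (1 - s) ^ m) by (apply pow_incr; lra).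
    apply Rle_trans with (c * (v r0 * (1 - r) ^ m)).
    { rewrite <- Rmult_assoc, <- Ec. apply Rmult_le_compat_r; lra. }
    rewrite Rmult_assoc. apply Rmult_le_compat_l; [lra|].
    apply Rle_trans with (1 := Hbig). apply Rmult_le_compat_l; lra.
  + assert (Hvr1 := Hmon r r0 ltac:(lra) ltac:(lra) ltac:(lra)).
    apply Rmult_le_compat; try lra. apply Rle_trans with (c * v r0); [lra|].
    apply Rmult_le_compat_l; lra.
Qed.

(** Before [r0'] the power [(1 - r)^(-b)] lies between [1] and [c], and [v] is non-increasing; if
    the threshold separates [s] from [r], it is inserted between them. *)
Lemma weight_le_Rpower (v : R -> R) : weight v ->
  (exists alpha' r0' : R, 0 < alpha' /\ 0 < r0' < 1 /\
     decreasing_from r0' (fun r => v r * Rpower (1 - r) (- alpha'))) ->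
  exists (c b : R), 0 < c /\ 0 < b /\
    forall s r, 0 <= s -> s <= r -> r < 1 ->
      v r * Rpower (1 - r) (- b) <= c * (v s * Rpower (1 - s) (- b)).
Proof.
intros [Hpos [_ Hmon]] [b [r0 [Hb [Hr0 Hdec]]]].
set (c := Rpower (1 - r0) (- b)).
assert (Hone : forall s, 0 <= s < 1 -> 1 <= Rpower (1 - s) (- b)).
{ intros s Hs. replace 1 with (Rpower (1 - s) 0) at 1 by (apply Rpower_O; lra).
  rewrite Rpower_Ropp. rewrite Rpower_O by lra.
  rewrite <- Rinv_1. apply Rinv_le_contravar; [apply exp_pos|].
  replace 1 with (Rpower 1 b) at 2.
  - apply Rle_Rpower_l; lra.
  - unfold Rpower. rewrite ln_1, Rmult_0_r. apply exp_0. }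
assert (Hanti : forall s r, s <= r -> r < 1 -> Rpower (1 - s) (- b) <= Rpower (1 - r) (- b)).
{ intros s r Hsr Hr. rewrite !Rpower_Ropp. apply Rinv_le_contravar; [apply exp_pos|].
  apply Rle_Rpower_l; lra. }
assert (Hc : 1 <= c) by (apply Hone; lra).
exists c, b. split; [lra|]. split; [exact Hb|]. intros s r Hs Hsr Hr.
assert (Hvs := Hpos s ltac:(lra)). assert (Hvr := Hpos r ltac:(lra)).
assert (Hvrs := Hmon s r Hs Hsr Hr).
assert (H1 := Hone s ltac:(lra)). assert (H2 := Hone r ltac:(lra)).
destruct (Rle_lt_dec r0 s) as [H|H].
- assert (K := Hdec s r H Hsr Hr). simpl in K.
  assert (0 <= v s * Rpower (1 - s) (- b)) by (apply Rmult_le_pos; lra). nra.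
- destruct (Rle_lt_dec r0 r) as [H'|H'].
  + assert (K := Hdec r0 r ltac:(lra) H' Hr). simpl in K. fold c in K.
    assert (K2 := Hmon s r0 Hs ltac:(lra) ltac:(lra)).
    apply Rle_trans with (1 := K). assert (Hvr0 := Hpos r0 ltac:(lra)).
    apply Rle_trans with (v s * c); [apply Rmult_le_compat_r; lra|].
    assert (0 <= c * v s) by (apply Rmult_le_pos; lra). nra.
  + assert (K := Hanti r r0 ltac:(lra) ltac:(lra)). fold c in K.
    apply Rle_trans with (v s * c); [apply Rmult_le_compat; lra|].
    assert (0 <= c * v s) by (apply Rmult_le_pos; lra). nra.
Qed.

(** The factor [r] is the length element on the ray to a point of modulus [r], parametrized by
    [[0,1]]. *)
Lemma is_RInt_Rpower (r b : R) : 0 <= r < 1 -> 0 < b ->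
  is_RInt (fun t => r * Rpower (1 - t * r) (- b - 1)) 0 1
    ((Rpower (1 - r) (- b) - 1) / b).
Proof.
intros Hr Hb.
replace ((Rpower (1 - r) (- b) - 1) / b)
  with (minus (Rpower (1 - 1 * r) (- b) / b) (Rpower (1 - 0 * r) (- b) / b)).
2: { unfold minus, plus, opp; simpl. replace (1 - 0 * r) with 1 by ring. rewrite Rmult_1_l.
     replace (Rpower 1 (- b)) with 1. field; lra.
     unfold Rpower. now rewrite ln_1, Rmult_0_r, exp_0. }
apply (is_RInt_derive (V := R_CompleteNormedModule) (fun t => Rpower (1 - t * r) (- b) / b)).
- intros t Ht. rewrite Rmin_left, Rmax_right in Ht by lra.
  assert (Hp : 0 < 1 - t * r) by nra.
  unfold Rpower. auto_derive; [exact Hp|].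
  replace ((- b - 1) * ln (1 - t * r)) with (- b * ln (1 - t * r) + - ln (1 - t * r)) by ring.
  rewrite exp_plus, exp_Ropp, exp_ln by exact Hp. change (1 + - (t * r)) with (1 - t * r). field. lra.
- intros t Ht. rewrite Rmin_left, Rmax_right in Ht by lra.
  assert (Hp : 0 < 1 - t * r) by nra.
  apply (ex_derive_continuous (V := R_NormedModule)). unfold Rpower. auto_derive. exact Hp.
Qed.

(** * Functions on rays and on compact subdiscs *)

Lemma Cmod_le_Rabs (x y : R) : Cmod (x, y) <= Rabs x + Rabs y.
Proof.
replace ((x, y) : C) with (RtoC x + Ci * RtoC y)%C
  by (unfold Ci, RtoC, Cmult, Cplus; simpl; f_equal; ring).
apply Rle_trans with (1 := Cmod_triangle _ _). rewrite Cmod_mult, Cmod_Ci, !Cmod_R. lra.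
Qed.

Lemma Cmod_tz (t : R) (z : C) : 0 <= t -> Cmod (0 + t * (z - 0)) = t * Cmod z.
Proof.
intros Ht. replace (0 + t * (z - 0))%C with (t * z)%C by ring. now apply Cmod_scal_R.
Qed.

Section Disc.
Variable h : C -> C.
Hypothesis h_diff : forall z, in_disc z -> cdiff h z.

Lemma disc_cont_on_ray (z : C) : in_disc z -> cont_on_seg h 0 z.
Proof.
intros Hz t Ht. apply cdiff_ccont, h_diff. unfold in_disc in *. rewrite Cmod_tz by lra.
assert (K := Cmod_ge_0 z). nra.
Qed.

(** Compactness of a square in gauge form. The gauge at a point is taken so small that its inverse
    bounds [|h|] on the surrounding box; a uniform lower bound [d] for the gauges in use then gives
    the bound [/ d]. At centres outside the closed disc the gauge keeps the box away from the disc,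
    so there is nothing to prove. *)
Lemma disc_bounded (rho : R) : 0 <= rho < 1 ->
  exists A, 0 <= A /\ forall z, Cmod z <= rho -> Cmod (h z) <= A.
Proof.
intros Hrho.
assert (Hloc : forall u v : R, {d : posreal | forall x y : R, Rabs (x - u) < d -> Rabs (y - v) < d ->
  Cmod (x, y) <= rho -> Cmod (h (x, y)) <= / d}).
{ intros u v. apply constructive_indefinite_description.
  assert (Hbox : forall x y e, Rabs (x - u) < e -> Rabs (y - v) < e -> Cmod ((x, y) - (u, v)) < 2 * e).
  { intros x y e Hx Hy.
    change ((x, y) - (u, v))%C with ((x - u)%R, (y - v)%R).
    apply Rle_lt_trans with (1 := Cmod_le_Rabs _ _). lra. }
  destruct (Rle_lt_dec (Cmod (u, v)) rho) as [Hin|Hout].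
  - destruct (cdiff_ccont h (u, v) (h_diff (u, v) ltac:(unfold in_disc; lra)) 1 Rlt_0_1) as [d [Hd1 Hd2]].
    assert (Hh := Cmod_ge_0 (h (u, v))).
    assert (He : 0 < Rmin (d / 2) (/ (1 + Cmod (h (u, v))))).
    { apply Rmin_glb_lt; [lra|]. apply Rinv_0_lt_compat; lra. }
    exists (mkposreal _ He). intros x y Hx Hy _. simpl in *.
    assert (K := Hd2 (x, y)). specialize (K ltac:(
      apply Rlt_le_trans with (1 := Hbox _ _ _ Hx Hy);
      assert (K2 := Rmin_l (d / 2) (/ (1 + Cmod (h (u, v))))); lra)).
    apply Rle_trans with (1 + Cmod (h (u, v))).
    + replace (h (x, y)) with ((h (x, y) - h (u, v)) + h (u, v))%C by ring.
      apply Rle_trans with (1 := Cmod_triangle _ _). lra.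
    + apply Rle_trans with (/ / (1 + Cmod (h (u, v)))); [right; now rewrite Rinv_inv|].
      apply Rinv_le_contravar; [exact He|apply Rmin_r].
  - assert (He : 0 < (Cmod (u, v) - rho) / 2) by lra.
    exists (mkposreal _ He). intros x y Hx Hy Hxy. simpl in *. exfalso.
    assert (K := Hbox _ _ _ Hx Hy). assert (T := Cmod_triangle (x, y) (- ((x, y) - (u, v)))).
    rewrite Cmod_opp in T.
    assert (E : ((x, y) + - ((x, y) - (u, v)) = (u, v))%C)
      by (unfold Cminus, Cplus, Copp; simpl; f_equal; ring).
    rewrite E in T. lra. }
destruct (compactness_value_2d (- rho) rho (- rho) rho (fun u v => proj1_sig (Hloc u v))) as [d Hd].
exists (/ d). split; [left; apply Rinv_0_lt_compat, cond_pos|].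
intros [x y] Hz.
assert (Hx : - rho <= x <= rho).
{ apply Rabs_le_between. apply Rle_trans with (2 := Hz). exact (re_le_Cmod (x, y)). }
assert (Hy : - rho <= y <= rho).
{ apply Rabs_le_between. apply Rle_trans with (2 := Hz).
  apply Rle_trans with (2 := Rmax_Cmod (x, y)). apply Rmax_r. }
(* The compactness statement is doubly negated. *)
apply NNPP. intros Hn. apply (Hd x y Hx Hy). intros [u [v [_ [_ [H1 [H2 H3]]]]]]. apply Hn.
apply Rle_trans with (1 := proj2_sig (Hloc u v) x y H1 H2 Hz).
apply Rinv_le_contravar; [apply cond_pos|exact H3].
Qed.
End Disc.

(** * Weighted estimates for primitives and derivatives *)

Lemma cdiff_ext_loc (f g : C -> C) (z : C) (d : R) : 0 < d ->
  (forall u, Cmod (u - z) < d -> f u = g u) -> cdiff f z -> cdiff g z.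
Proof.
intros Hd E [l Hl]. exists l. intros eps Heps.
destruct (Hl eps Heps) as [d' [Hd' H]].
exists (Rmin d d'). split; [now apply Rmin_glb_lt|]. intros u Hu.
rewrite <- (E u), <- (E z).
- apply H. apply Rlt_le_trans with (1 := Hu), Rmin_r.
- replace (z - z)%C with (RtoC 0) by ring. now rewrite Cmod_0.
- apply Rlt_le_trans with (1 := Hu), Rmin_l.
Qed.

(* [Vop g f] and [Top g f] are convertible to [Cint_seg h 0] and [ray_mean h] for [h = f g']. *)
Definition ray_mean (h : C -> C) (z : C) : C :=
  if Ceq_dec z 0%C then h 0%C else (/ z * Cint_seg h 0 z)%C.

Section Ray.
Variable h : C -> C.
Hypothesis h_diff : forall z, in_disc z -> cdiff h z.

Lemma cdiff_primitive (z : C) : in_disc z -> cdiff (Cint_seg h 0) z.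
Proof. intros Hz. exists (h z). now apply cderiv_primitive. Qed.

Lemma Cint_seg_ray_mean (z : C) : in_disc z -> Cint_seg h 0 z = (z * ray_mean h z)%C.
Proof.
intros Hz. unfold ray_mean. destruct (Ceq_dec z 0) as [->|H].
- unfold Cint_seg. ring.
- field. exact H.
Qed.

(** Dividing by [z] cancels the factor [z - 0] in [Cint_seg]: what remains is the average of [h]
    over the segment from [0] to [z]. *)
Lemma ray_mean_le (z : C) (M : R) : in_disc z ->
  (forall t, 0 <= t <= 1 -> Cmod (h (0 + t * (z - 0))%C) <= M) -> Cmod (ray_mean h z) <= M.
Proof.
intros Hz H. unfold ray_mean. destruct (Ceq_dec z 0) as [->|Hz0].
- specialize (H 0 ltac:(lra)). now replace (0 + 0 * (0 - 0))%C with (RtoC 0) in H by ring.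
- unfold Cint_seg.
  assert (K : forall I : C, (/ z * ((z - 0) * I) = I)%C) by (intros I; field; exact Hz0).
  rewrite K. apply CRInt_le_const; [|exact H]. now apply ex_CRInt_seg, disc_cont_on_ray.
Qed.

(* At the origin, [h x = h 0 + l x + o(x)] integrates to [ray_mean h u = h 0 + l u / 2 + o(u)]. *)
Lemma cdiff_ray_mean (z : C) : in_disc z -> cdiff (ray_mean h) z.
Proof.
intros Hz. destruct (Ceq_dec z 0) as [->|Hz0].
- destruct (h_diff 0 Hz) as [l Hl]. exists (l / 2)%C. intros eps Heps.
  destruct (Hl eps Heps) as [d [Hd H]].
  exists (Rmin d 1). split; [apply Rmin_glb_lt; lra|]. intros u Hu.
  assert (Hu1 := Rlt_le_trans _ _ _ Hu (Rmin_l _ _)).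
  assert (Hu2 := Rlt_le_trans _ _ _ Hu (Rmin_r _ _)).
  unfold ray_mean at 2. destruct (Ceq_dec 0 0) as [_|E]; [|now elim E].
  unfold ray_mean. destruct (Ceq_dec u 0) as [->|Hu0].
  { replace (h 0 - h 0 - l / 2 * (0 - 0))%C with (RtoC 0) by (field).
    rewrite Cmod_0. apply Rmult_le_pos; [lra|apply Cmod_ge_0]. }
  replace (u - 0)%C with u in * by ring.
  assert (Hdisc : in_disc u) by exact Hu2.
  replace (/ u * Cint_seg h 0 u - h 0 - l / 2 * u)%C
    with (/ u * Cint_seg (fun x => h x - (h 0 + l * (x - 0)))%C 0 u)%C.
  2: { rewrite (Cint_seg_minus h (fun x => h 0 + l * (x - 0))%C).
       - rewrite Cint_seg_affine. field. exact Hu0.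
       - now apply disc_cont_on_ray.
       - intros t _. eapply cderiv_ccont, cderiv_affine. }
  assert (Hp := proj1 (Cmod_gt_0 u) Hu0).
  rewrite Cmod_mult, Cmod_inv by exact Hu0.
  apply Rle_trans with (/ Cmod u * (Cmod (u - 0) * (eps * Cmod u))).
  2: { replace (u - 0)%C with u by ring. right. field. lra. }
  apply Rmult_le_compat_l; [left; now apply Rinv_0_lt_compat|].
  apply Cint_seg_bound.
  + intros t Ht. apply cdiff_ccont, cdiff_minus.
    * apply h_diff. unfold in_disc in *. rewrite Cmod_tz by lra. nra.
    * eexists. apply cderiv_affine.
  + intros t Ht. specialize (H (0 + t * (u - 0))%C).
    replace (0 + t * (u - 0) - 0)%C with (0 + t * (u - 0))%C in H by ring.
    rewrite Cmod_tz in H by lra.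
    replace (h (0 + t * (u - 0)) - (h 0 + l * (0 + t * (u - 0) - 0)))%C
      with (h (0 + t * (u - 0)) - h 0 - l * (0 + t * (u - 0)))%C by ring.
    apply Rle_trans with (eps * (t * Cmod u)); [apply H; nra|].
    apply Rmult_le_compat_l; nra.
- apply (cdiff_ext_loc (fun u => / u * Cint_seg h 0 u)%C _ _ (Cmod z)).
  + now apply Cmod_gt_0.
  + intros u Hu. unfold ray_mean. destruct (Ceq_dec u 0) as [->|_]; [|reflexivity].
    rewrite Cmod_minus_sym in Hu. replace (z - 0)%C with z in Hu by ring. lra.
  + apply cdiff_mult; [|now apply cdiff_primitive].
    apply (cdiff_inv (fun u => u)); [apply cdiff_id|exact Hz0].
Qed.

(* If [v r (1-r)^(-b)] is almost decreasing then [v r int_0^r ds / ((1-s) v s) <= c / b]. *)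
Lemma primitive_weight_bound (v : R -> R) (c b A N : R) (z : C) :
  (forall r, 0 <= r < 1 -> 0 < v r) ->
  0 < c -> 0 < b ->
  (forall s r, 0 <= s -> s <= r -> r < 1 ->
      v r * Rpower (1 - r) (- b) <= c * (v s * Rpower (1 - s) (- b))) ->
  in_disc z -> 0 <= A -> 0 <= N ->
  (forall u, Cmod u <= Cmod z -> Cmod (h u) <= A + N / ((1 - Cmod u) * v (Cmod u))) ->
  Cmod (Cint_seg h 0 z) * v (Cmod z) <= A * v (Cmod z) + N * (c / b).
Proof.
intros Hpos Hc Hb Hcb Hz HA HN H.
assert (Hr0 := Cmod_ge_0 z). unfold in_disc in Hz.
set (r := Cmod z) in *.
assert (Hvr := Hpos r ltac:(lra)).
assert (Hq : 0 < Rpower (1 - r) (- b)) by apply exp_pos.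
set (q := Rpower (1 - r) (- b)) in *.
(* By almost-monotonicity [1 / v s <= c (1 - s)^(-b) / (v r * q)] for [s <= r], so the integrand is
   at most [A + k (1 - s)^(-b-1)] along the ray, and the power integrates explicitly. *)
set (k := N * c / (v r * q)).
assert (Hk : 0 <= k). { unfold k. apply Rdiv_le_0_compat; nra. }
assert (HI := is_RInt_Rpower r b ltac:(lra) Hb). fold q in HI.
apply (is_RInt_scal (V := R_NormedModule) _ _ _ k) in HI.
assert (HI2 := is_RInt_plus (V := R_NormedModule) _ _ _ _ _ _ (is_RInt_const (V := R_NormedModule) 0 1 A) HI).
assert (Hex := ex_CRInt_seg h 0 z (disc_cont_on_ray h h_diff z Hz)).
assert (E : Cint_seg h 0 z = CRInt (fun t : R => (z - 0) * h (0 + t * (z - 0)))%C 0 1).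
{ unfold Cint_seg. symmetry. now apply CRInt_Cmult. }
assert (B : Cmod (Cint_seg h 0 z) <= A + k * ((q - 1) / b)).
{ rewrite E.
  replace (A + k * ((q - 1) / b)) with (plus (scal (1 - 0) A) (scal k ((q - 1) / b))).
  2: { change ((1 - 0) * A + k * ((q - 1) / b) = A + k * ((q - 1) / b)). ring. }
  apply (CRInt_le _ _ _) with (2 := HI2).
  - eexists. apply is_CRInt_Cmult. exact (RInt_correct (V := C_R_CompleteNormedModule) _ _ _ Hex).
  - intros t Ht. change (Cmod ((z - 0) * h (0 + t * (z - 0))) <= A + k * (r * Rpower (1 - t * r) (- b - 1))).
    rewrite Cmod_mult. replace (Cmod (z - 0)) with r by (unfold r; f_equal; ring).
    assert (Hm : Cmod (0 + t * (z - 0)) = t * r) by (apply Cmod_tz; lra).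
    specialize (H (0 + t * (z - 0))%C). rewrite Hm in H. fold r in H.
    assert (Htr : 0 <= t * r <= r) by nra.
    specialize (H ltac:(lra)).
    assert (Hvt := Hpos (t * r) ltac:(lra)).
    specialize (Hcb (t * r) r ltac:(lra) ltac:(lra) Hz). fold q in Hcb.
    apply Rle_trans with (r * (A + N / ((1 - t * r) * v (t * r)))); [apply Rmult_le_compat_l; lra|].
    replace (Rpower (1 - t * r) (- b - 1)) with (Rpower (1 - t * r) (- b) / (1 - t * r)).
    2: { unfold Rminus at 4. rewrite Rpower_plus, (Rpower_Ropp _ 1), Rpower_1 by lra. reflexivity. }
    set (p := Rpower (1 - t * r) (- b)) in *.
    assert (Hd : N / ((1 - t * r) * v (t * r)) <= k * (p / (1 - t * r))).
    { unfold k.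
      replace (N / ((1 - t * r) * v (t * r)))
        with (N / ((1 - t * r) * v (t * r) * (v r * q)) * (v r * q)) by (field; repeat split; lra).
      replace (N * c / (v r * q) * (p / (1 - t * r)))
        with (N / ((1 - t * r) * v (t * r) * (v r * q)) * (c * (v (t * r) * p))) by (field; repeat split; lra).
      apply Rmult_le_compat_l; [|exact Hcb].
      apply Rdiv_le_0_compat; [exact HN|]. repeat apply Rmult_lt_0_compat; lra. }
    assert (r * A <= A) by nra. nra. }
apply (Rmult_le_compat_r (v r)) in B; [|lra].
apply Rle_trans with (1 := B).
rewrite Rmult_plus_distr_r. apply Rplus_le_compat_l.
unfold k. replace (N * c / (v r * q) * ((q - 1) / b) * v r) with (N * (c / b) * ((q - 1) / q)) by (field; repeat split; lra).
assert (0 <= N * (c / b)). { apply Rmult_le_pos; auto. apply Rdiv_le_0_compat; lra. }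
assert ((q - 1) / q <= 1). { apply (Rmult_le_reg_r q); auto. unfold Rdiv. rewrite Rmult_assoc, Rinv_l; lra. }
nra.
Qed.
End Ray.

(* If [v r (1-r)^(-m)] is almost increasing then [v] varies by a bounded factor on the disc of
   radius [(1-|z|)/2] about [z], to which the Cauchy estimate is applied. *)
Lemma derivative_weight_bound (v : R -> R) (c : R) (m : nat) (F h : C -> C) (z : C) (N : R) :
  weight v -> 0 < c ->
  (forall s r, 0 <= s -> s <= r -> r < 1 -> v s * (1 - r) ^ m <= c * v r * (1 - s) ^ m) ->
  (forall u, in_disc u -> cderiv F u (h u)) -> in_disc z ->
  (forall u, Cmod (u - z) <= (1 - Cmod z) / 2 -> Cmod (F u) * v (Cmod u) <= N) ->
  Cmod (h z) * ((1 - Cmod z) * v (Cmod z)) <= 32 * c * 2 ^ m * N.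
Proof.
intros [Hpos [_ Hmon]] Hc Hcm HF Hz HN. unfold in_disc in Hz.
assert (Hr0 := Cmod_ge_0 z). set (r := Cmod z) in *.
assert (Hball : forall u, Cmod (u - z) <= (1 - r) / 2 -> Cmod u <= (1 + r) / 2).
{ intros u Hu. replace u with ((u - z) + z)%C by ring.
  apply Rle_trans with (1 := Cmod_triangle _ _). fold r. lra. }
(* The largest modulus in the disc, where [v] is smallest. As [1 - R1] is half of [1 - r], the
   factor lost in passing from [v r] to [v R1] is [c * 2 ^ m]. *)
set (R1 := (1 + r) / 2) in *.
assert (HR1 : 0 < v R1) by (apply Hpos; unfold R1; lra).
assert (Hv : v r <= c * 2 ^ m * v R1).
{ assert (K := Hcm r R1 Hr0 ltac:(unfold R1; lra) ltac:(unfold R1; lra)).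
  replace (1 - R1) with ((1 - r) / 2) in K by (unfold R1; field).
  unfold Rdiv in K. rewrite Rpow_mult_distr, pow_inv in K.
  assert (H2 : 0 < 2 ^ m) by (apply pow_lt; lra).
  assert (Hp : 0 < (1 - r) ^ m) by (apply pow_lt; lra).
  apply (Rmult_le_reg_r (/ 2 ^ m * (1 - r) ^ m)).
  - apply Rmult_lt_0_compat; auto. now apply Rinv_0_lt_compat.
  - replace (c * 2 ^ m * v R1 * (/ 2 ^ m * (1 - r) ^ m)) with (c * v R1 * (1 - r) ^ m) by (field; lra).
    lra. }
assert (HN0 : 0 <= N).
{ apply Rle_trans with (2 := HN z ltac:(replace (z - z)%C with (RtoC 0) by ring; rewrite Cmod_0; fold r; lra)).
  apply Rmult_le_pos; [apply Cmod_ge_0|]. left; apply Hpos; fold r; lra. }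
(* Cauchy's estimate uses the disc of radius [2 s], so [s] is [(1 - r) / 4]; this makes the constant
   [8 * 4 = 32]. *)
assert (HC : Cmod (h z) <= 8 * (N / v R1) / ((1 - r) / 4)).
{ apply (cauchy_estimate F z).
  - lra.
  - intros u Hu. exists (h u). apply HF. unfold in_disc.
    specialize (Hball u ltac:(lra)). unfold R1 in Hball. lra.
  - intros u Hu. specialize (Hball u ltac:(lra)). specialize (HN u ltac:(lra)).
    apply (Rmult_le_reg_r (v R1)); auto. unfold Rdiv. rewrite Rmult_assoc, Rinv_l by lra.
    rewrite Rmult_1_r. apply Rle_trans with (2 := HN).
    apply Rmult_le_compat_l; [apply Cmod_ge_0|]. apply Hmon; auto; [apply Cmod_ge_0|unfold R1; lra].
  - now apply HF. }
assert (Hvr := Hpos r ltac:(lra)).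
apply (Rmult_le_compat_r ((1 - r) * v r)) in HC; [|nra].
apply Rle_trans with (1 := HC).
replace (8 * (N / v R1) / ((1 - r) / 4) * ((1 - r) * v r)) with (32 * (N / v R1) * v r) by (field; lra).
replace (32 * c * 2 ^ m * N) with (32 * (N / v R1) * (c * 2 ^ m * v R1)) by (field; lra).
apply Rmult_le_compat_l; [|exact Hv].
apply Rmult_le_pos; [lra|]. now apply Rdiv_le_0_compat.
Qed.

(** * Optimal domains *)

Definition weighted_le (v : R -> R) (F : C -> C) (N : R) : Prop :=
  forall z, in_disc z -> Cmod (F z) * v (Cmod z) <= N.

(** The boundary clause in the membership of [Hzero v], isolated from analyticity. *)
Definition vanishing (v : R -> R) (F : C -> C) : Prop :=
  forall eps, 0 < eps -> exists rho, 0 <= rho < 1 /\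
    forall z : C, rho < Cmod z < 1 -> Cmod (F z) * v (Cmod z) < eps.

Lemma in_disc_0 : in_disc 0.
Proof. unfold in_disc. rewrite Cmod_0. lra. Qed.

Lemma wnorm_ub (v : R -> R) (F : C -> C) (z : C) :
  in_disc z -> Rbar_le (Cmod (F z) * v (Cmod z)) (wnorm v F).
Proof.
intros Hz. unfold wnorm.
apply (proj1 (Lub_Rbar_correct (fun y => exists z : C, in_disc z /\ y = Cmod (F z) * v (Cmod z)))).
now exists z.
Qed.

Lemma wnorm_le_finite (v : R -> R) (F : C -> C) (N : R) :
  Rbar_le (wnorm v F) N <-> weighted_le v F N.
Proof.
split.
- intros H z Hz. exact (Rbar_le_trans _ _ _ (wnorm_ub v F z Hz) H).
- intros H.
  apply (proj2 (Lub_Rbar_correct (fun y => exists z : C, in_disc z /\ y = Cmod (F z) * v (Cmod z)))).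
  intros y [z [Hz ->]]. exact (H z Hz).
Qed.

Lemma wnorm_ge_0 (v : R -> R) (F : C -> C) :
  (forall r, 0 <= r < 1 -> 0 < v r) -> Rbar_le 0 (wnorm v F).
Proof.
intros Hv. apply Rbar_le_trans with (2 := wnorm_ub v F 0 in_disc_0).
apply Rmult_le_pos; [apply Cmod_ge_0|]. left. apply Hv. rewrite Cmod_0. lra.
Qed.

(** Reduces an inequality of [Rbar] norms to estimates with a finite bound. Positivity of [K]
    matters when the norm is [p_infty], because [Rbar_mult] makes [0] times [p_infty] equal to
    [0]. *)
Lemma wnorm_le_mult (v w : R -> R) (F G : C -> C) (K : R) : 0 < K ->
  (forall r, 0 <= r < 1 -> 0 < v r) ->
  (forall N, 0 <= N -> weighted_le v F N -> weighted_le w G (K * N)) ->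
  Rbar_le (wnorm w G) (Rbar_mult K (wnorm v F)).
Proof.
intros HK Hv H.
assert (H0 := wnorm_ge_0 v F Hv).
assert (HF := proj1 (wnorm_le_finite v F (wnorm v F))).
destruct (wnorm v F) as [N| |] eqn:E.
- apply wnorm_le_finite, H; [exact H0|]. apply HF, Rbar_le_refl.
- unfold Rbar_mult, Rbar_mult'. destruct (Rle_dec 0 K) as [HK'|]; [|lra].
  destruct (Rle_lt_or_eq_dec 0 K HK'); [|lra]. now destruct (wnorm w G).
- destruct H0.
Qed.

Lemma wnorm_lt_p_infty (v : R -> R) (F : C -> C) :
  (forall r, 0 <= r < 1 -> 0 < v r) ->
  Rbar_lt (wnorm v F) p_infty <-> exists N, 0 <= N /\ weighted_le v F N.
Proof.
intros Hv. assert (H0 := wnorm_ge_0 v F Hv).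
split.
- assert (HF := proj1 (wnorm_le_finite v F (wnorm v F))).
  destruct (wnorm v F) as [N| |]; intros H; [|easy|easy].
  exists N. split; [exact H0|]. apply HF, Rbar_le_refl.
- intros [N [_ HN]]. apply wnorm_le_finite in HN.
  destruct (wnorm v F) as [x| |]; [exact I|easy|easy].
Qed.

Lemma equivalent_norms_intro (X Y : fspace) (K L : R) : 0 < K -> 0 < L ->
  (forall f, X f -> Rbar_le 0 (fnorm X f) /\ Rbar_le 0 (fnorm Y f) /\
     Rbar_le (fnorm Y f) (Rbar_mult K (fnorm X f)) /\
     Rbar_le (fnorm X f) (Rbar_mult L (fnorm Y f))) ->
  equivalent_norms X Y.
Proof.
intros HK HL H. exists (/ K), L. split; [now apply Rinv_0_lt_compat|]. split; [exact HL|].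
intros f Hf. destruct (H f Hf) as [Hx0 [Hy0 [H1 H2]]]. split; [|exact H2].
destruct (fnorm X f) as [x| |], (fnorm Y f) as [y| |]; simpl in *; try easy.
- apply (Rmult_le_reg_l K); auto. rewrite <- Rmult_assoc, Rinv_r; lra.
- unfold Rbar_mult, Rbar_mult'. destruct (Rle_dec 0 (/ K)) as [HK'|]; [|easy].
  now destruct (Rle_lt_or_eq_dec 0 (/ K) HK').
Qed.

Lemma filterlim_at_left_0 (v : R -> R) : filterlim v (at_left 1) (locally 0) ->
  forall eps, 0 < eps -> exists rho, 0 <= rho < 1 /\ forall r, rho < r < 1 -> v r < eps.
Proof.
intros H eps Heps.
destruct (H (fun y => Rabs (y - 0) < eps)) as [d Hd].
{ exists (mkposreal eps Heps). intros y Hy. exact Hy. }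
exists (Rmax 0 (1 - d)). split.
- split; [apply Rmax_l|]. apply Rmax_lub_lt; [lra|]. assert (K := cond_pos d). lra.
- intros r [Hr1 Hr2]. assert (K := Rmax_r 0 (1 - d)).
  assert (Hb : Rabs (v r - 0) < eps).
  { apply Hd; [|exact Hr2]. change (Rabs (r - 1) < d). rewrite Rabs_left; lra. }
  apply Rle_lt_trans with (2 := Hb). rewrite Rminus_0_r. apply Rle_abs.
Qed.

(** * [V_g] and [T_g] between the weights [w] and [v] *)

Section Operators.
Variables (v : R -> R) (g : C -> C).
Let G := C_derive g.
Let w := fun r : R => (1 - r) * v r.
Hypothesis v_weight : weight v.
Variables (M1 M2 c1 c2 b : R) (m : nat).
Hypothesis M1_pos : 0 < M1.
Hypothesis M2_pos : 0 < M2.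
Hypothesis c1_pos : 0 < c1.
Hypothesis c2_pos : 0 < c2.
Hypothesis b_pos : 0 < b.
Hypothesis G_diff : forall z, in_disc z -> cdiff G z.
Hypothesis G_le : forall z, in_disc z -> Cmod (G z) <= M1.
Hypothesis G_neq0 : forall z, in_disc z -> G z <> 0%C.
Hypothesis Ginv_le : forall z, in_disc z -> Cmod (/ G z) <= M2.
Hypothesis v_pow : forall s r, 0 <= s -> s <= r -> r < 1 ->
  v s * (1 - r) ^ m <= c1 * v r * (1 - s) ^ m.
Hypothesis v_Rpower : forall s r, 0 <= s -> s <= r -> r < 1 ->
  v r * Rpower (1 - r) (- b) <= c2 * (v s * Rpower (1 - s) (- b)).

Lemma v_pos (r : R) : 0 <= r < 1 -> 0 < v r.
Proof. apply v_weight. Qed.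

Lemma w_pos (r : R) : 0 <= r < 1 -> 0 < w r.
Proof. intros Hr. unfold w. assert (K := v_pos r Hr). nra. Qed.

Lemma v_Cmod_pos (z : C) : in_disc z -> 0 < v (Cmod z).
Proof. intros Hz. apply v_pos. split; [apply Cmod_ge_0|exact Hz]. Qed.

Section Integrand.
Variable f : C -> C.
Hypothesis f_diff : forall z, in_disc z -> cdiff f z.
Let h := fun xi : C => (f xi * G xi)%C.

Lemma integrand_cdiff (z : C) : in_disc z -> cdiff h z.
Proof. intros Hz. apply cdiff_mult; auto. Qed.

Lemma Vop_cdiff (z : C) : in_disc z -> cdiff (Vop g f) z.
Proof. exact (cdiff_primitive h integrand_cdiff z). Qed.

Lemma Top_cdiff (z : C) : in_disc z -> cdiff (Top g f) z.
Proof. exact (cdiff_ray_mean h integrand_cdiff z). Qed.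

Lemma Vop_Top (z : C) : in_disc z -> Cmod (Vop g f z) = Cmod z * Cmod (Top g f z).
Proof. intros Hz. rewrite <- Cmod_mult. f_equal. exact (Cint_seg_ray_mean h z Hz). Qed.

Lemma Vop_le_Top (N : R) : weighted_le v (Top g f) N -> weighted_le v (Vop g f) N.
Proof.
intros H z Hz. apply Rle_trans with (2 := H z Hz).
apply Rmult_le_compat_r; [left; now apply v_Cmod_pos|].
rewrite Vop_Top by exact Hz. assert (K := Cmod_ge_0 (Top g f z)). unfold in_disc in Hz. nra.
Qed.

Lemma Top_le_Vop_far (z : C) : / 2 <= Cmod z < 1 ->
  Cmod (Top g f z) * v (Cmod z) <= 2 * (Cmod (Vop g f z) * v (Cmod z)).
Proof.
intros Hz. rewrite Vop_Top by exact (proj2 Hz).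
assert (K := Cmod_ge_0 (Top g f z)). assert (K2 := v_Cmod_pos z (proj2 Hz)).
assert (0 <= Cmod (Top g f z) * v (Cmod z)) by (apply Rmult_le_pos; lra). nra.
Qed.

Lemma integrand_le (z : C) (N : R) : in_disc z -> Cmod (f z) * w (Cmod z) <= N ->
  Cmod (h z) <= M1 * N / ((1 - Cmod z) * v (Cmod z)).
Proof.
intros Hz H. unfold h. rewrite Cmod_mult.
assert (Hw := w_pos (Cmod z) (conj (Cmod_ge_0 z) Hz)). unfold w in *.
apply (Rmult_le_reg_r ((1 - Cmod z) * v (Cmod z))); auto.
unfold Rdiv. rewrite (Rmult_assoc (M1 * N)), Rinv_l, Rmult_1_r by lra.
replace (Cmod (f z) * Cmod (G z) * ((1 - Cmod z) * v (Cmod z)))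
  with (Cmod (G z) * (Cmod (f z) * ((1 - Cmod z) * v (Cmod z)))) by ring.
apply Rmult_le_compat; auto; try apply Cmod_ge_0.
apply Rmult_le_pos; [apply Cmod_ge_0|lra].
Qed.

Lemma Vop_le_w (N : R) : 0 <= N -> weighted_le w f N ->
  weighted_le v (Vop g f) (M1 * (c2 / b) * N).
Proof.
intros HN H z Hz.
replace (M1 * (c2 / b) * N) with (0 * v (Cmod z) + M1 * N * (c2 / b)) by ring.
apply (primitive_weight_bound h integrand_cdiff); auto; try lra.
- exact v_pos.
- apply Rmult_le_pos; lra.
- intros u Hu. rewrite Rplus_0_l. unfold in_disc in Hz.
  assert (Hu' : in_disc u) by (unfold in_disc; lra). apply integrand_le; auto.
Qed.

(** Dividing by [z] costs at most a factor 2 when [|z| >= 1/2]. Nearer the origin [T_g f] is an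
    average of [f g'] over a ray on which [1 - |u| >= 1/2] and [v (|u|) >= v (|z|)]. *)
Lemma Top_le_w (N : R) : 0 <= N -> weighted_le w f N ->
  weighted_le v (Top g f) (2 * M1 * (c2 / b + 1) * N).
Proof.
intros HN H z Hz.
assert (Hcb : 0 <= c2 / b) by (apply Rdiv_le_0_compat; lra).
assert (HMN : 0 <= M1 * N) by (apply Rmult_le_pos; lra).
destruct (Rle_lt_dec (/ 2) (Cmod z)) as [Hfar|Hnear].
- apply Rle_trans with (1 := Top_le_Vop_far z (conj Hfar Hz)).
  assert (K := Vop_le_w N HN H z Hz). nra.
- apply Rle_trans with (2 * (M1 * N)); [|nra].
  assert (Hv := v_Cmod_pos z Hz).
  apply (Rmult_le_reg_r (/ v (Cmod z))); [now apply Rinv_0_lt_compat|].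
  rewrite (Rmult_assoc (Cmod (Top g f z))), Rinv_r, Rmult_1_r by lra.
  apply (ray_mean_le h integrand_cdiff z); auto.
  intros t Ht. assert (Hr := Cmod_ge_0 z).
  assert (Hm : Cmod (0 + t * (z - 0)) = t * Cmod z) by (apply Cmod_tz; lra).
  set (u := (0 + t * (z - 0))%C) in *.
  assert (Hu : 0 <= Cmod u <= Cmod z) by (rewrite Hm; nra).
  assert (Hud : in_disc u) by (unfold in_disc in *; lra).
  apply Rle_trans with (1 := integrand_le u N Hud (H u Hud)).
  unfold Rdiv. replace (2 * (M1 * N) * / v (Cmod z)) with (M1 * N * (2 * / v (Cmod z))) by ring.
  apply Rmult_le_compat_l; [exact HMN|].
  replace (2 * / v (Cmod z)) with (/ (/ 2 * v (Cmod z))) by (field; lra).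
  apply Rinv_le_contravar; [lra|]. apply Rmult_le_compat; try lra.
  apply v_weight; lra.
Qed.

Lemma f_le_integrand (z : C) (k : R) : in_disc z -> 0 <= k -> Cmod (f z) * k <= M2 * (Cmod (h z) * k).
Proof.
intros Hz Hk. replace (f z) with (/ G z * h z)%C by (unfold h; field; auto).
rewrite Cmod_mult. rewrite <- Rmult_assoc. apply Rmult_le_compat_r; auto.
apply Rmult_le_compat_r; [apply Cmod_ge_0|auto].
Qed.

(** Only values of [V_g f] on a disc about [z] are used, so the same estimate serves for bounded and
    for vanishing functions. *)
Lemma w_le_Vop_local (z : C) (N : R) : in_disc z ->
  (forall u, Cmod (u - z) <= (1 - Cmod z) / 2 -> Cmod (Vop g f u) * v (Cmod u) <= N) ->
  Cmod (f z) * w (Cmod z) <= M2 * (32 * c1 * 2 ^ m) * N.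
Proof.
intros Hz H. unfold w.
apply Rle_trans with (1 := f_le_integrand z _ Hz (Rlt_le _ _ (w_pos _ (conj (Cmod_ge_0 z) Hz)))).
rewrite Rmult_assoc. apply Rmult_le_compat_l; [lra|]. unfold w.
apply (derivative_weight_bound v c1 m (Vop g f) h); auto.
intros u Hu. exact (cderiv_primitive h u integrand_cdiff Hu).
Qed.

Lemma w_le_Vop (N : R) : weighted_le v (Vop g f) N ->
  weighted_le w f (M2 * (32 * c1 * 2 ^ m) * N).
Proof.
intros H z Hz. apply w_le_Vop_local; [exact Hz|]. intros u Hu. apply H.
unfold in_disc in *. replace u with ((u - z) + z)%C by ring.
apply Rle_lt_trans with (1 := Cmod_triangle _ _). lra.
Qed.

Lemma vanishing_Vop_Top : vanishing v (Vop g f) <-> vanishing v (Top g f).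
Proof.
split; intros H eps Heps.
- destruct (H (eps / 2)) as [rho [Hrho K]]; [lra|].
  exists (Rmax rho (/ 2)). split; [split|].
  + apply Rle_trans with (2 := Rmax_l _ _). lra.
  + apply Rmax_lub_lt; lra.
  + intros z Hz. assert (K1 := Rmax_l rho (/ 2)). assert (K2 := Rmax_r rho (/ 2)).
    assert (K3 := Top_le_Vop_far z ltac:(lra)). specialize (K z ltac:(lra)). lra.
- destruct (H eps Heps) as [rho [Hrho K]]. exists rho. split; [exact Hrho|].
  intros z Hz. specialize (K z Hz). apply Rle_lt_trans with (2 := K).
  rewrite Vop_Top by exact (proj2 Hz).
  apply Rmult_le_compat_r; [left; apply v_Cmod_pos, Hz|].
  assert (K2 := Cmod_ge_0 (Top g f z)). nra.
Qed.

Lemma vanishing_Vop_w : vanishing v (Vop g f) -> vanishing w f.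
Proof.
intros H eps Heps. set (K := M2 * (32 * c1 * 2 ^ m)).
assert (HK : 0 < K). { unfold K. repeat apply Rmult_lt_0_compat; try lra. apply pow_lt; lra. }
destruct (H (eps / (2 * K))) as [rho [Hrho HN]]; [apply Rdiv_lt_0_compat; lra|].
(* Points [u] of the disc satisfy [|u| >= (3 |z| - 1) / 2], which exceeds [rho] exactly when [|z|]
   exceeds this radius. *)
exists ((1 + 2 * rho) / 3). split; [lra|]. intros z Hz.
assert (E : K * (eps / (2 * K)) = eps / 2) by (field; lra).
apply Rle_lt_trans with (K * (eps / (2 * K))); [|lra].
apply w_le_Vop_local; [exact (proj2 Hz)|]. intros u Hu. left. apply HN.
assert (T1 := Cmod_triangle (u - z) z). replace (u - z + z)%C with u in T1 by ring.
assert (T2 := Cmod_triangle u (- (u - z))). replace (u + - (u - z))%C with z in T2 by ring.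
rewrite Cmod_opp in T2. lra.
Qed.

(** On [|u| <= rho] the integrand is bounded by a constant [A], which contributes [A v (|z|)] and
    tends to [0]; beyond [rho] its weighted size is small, and the primitive estimate preserves
    this. *)
Lemma vanishing_w_Vop : filterlim v (at_left 1) (locally 0) ->
  vanishing w f -> vanishing v (Vop g f).
Proof.
intros Hlim H eps Heps.
assert (Hcb : 0 < c2 / b) by (apply Rdiv_lt_0_compat; lra).
(* The outer part then contributes [eps / 4]; the inner one is kept below [eps / 2], with [A + 1] in
   the denominator because [A] may vanish. *)
set (e := eps / (4 * (M1 * (c2 / b)))).
assert (Hp := Rmult_lt_0_compat M1 (c2 / b) M1_pos Hcb).
assert (He : 0 < e) by (apply Rdiv_lt_0_compat; lra).
destruct (H e He) as [rho [Hrho Hf]].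
destruct (disc_bounded h integrand_cdiff rho Hrho) as [A [HA Hh]].
destruct (filterlim_at_left_0 v Hlim (eps / (2 * (A + 1)))) as [rho' [Hrho' Hv]].
{ apply Rdiv_lt_0_compat; lra. }
exists rho'. split; [exact Hrho'|]. intros z Hz.
assert (B : Cmod (Vop g f z) * v (Cmod z) <= A * v (Cmod z) + M1 * e * (c2 / b)).
{ apply (primitive_weight_bound h integrand_cdiff); auto; try lra.
  - exact v_pos.
  - exact (proj2 Hz).
  - apply Rmult_le_pos; lra.
  - intros u Hu. assert (Hud : in_disc u) by (unfold in_disc; lra).
    assert (Hw := w_pos (Cmod u) (conj (Cmod_ge_0 u) Hud)). unfold w in Hw.
    destruct (Rle_lt_dec (Cmod u) rho) as [Hin|Hout].
    + assert (K := Hh u Hin).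
      assert (0 <= M1 * e / ((1 - Cmod u) * v (Cmod u))). { apply Rdiv_le_0_compat; [nra|auto]. }
      lra.
    + assert (K := integrand_le u e Hud (Rlt_le _ _ (Hf u (conj Hout Hud)))). lra. }
apply Rle_lt_trans with (1 := B).
assert (E : M1 * e * (c2 / b) = eps / 4) by (unfold e; field; repeat split; lra).
specialize (Hv (Cmod z) Hz).
assert (A * v (Cmod z) <= eps / 2).
{ apply Rle_trans with (A * (eps / (2 * (A + 1)))); [apply Rmult_le_compat_l; lra|].
  apply (Rmult_le_reg_r (2 * (A + 1))); [lra|].
  replace (A * (eps / (2 * (A + 1))) * (2 * (A + 1))) with (A * eps) by (field; lra). nra. }
lra.
Qed.
End Integrand.

Let K_w := 2 * M1 * (c2 / b + 1).
Let K_V := M2 * (32 * c1 * 2 ^ m).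

Lemma K_w_pos : 0 < K_w.
Proof.
assert (0 < c2 / b) by (apply Rdiv_lt_0_compat; lra).
unfold K_w. repeat apply Rmult_lt_0_compat; lra.
Qed.

Lemma K_V_pos : 0 < K_V.
Proof. unfold K_V. repeat apply Rmult_lt_0_compat; try lra. apply pow_lt; lra. Qed.

Lemma norm_Vop_le_Top (f : C -> C) : analytic f ->
  Rbar_le (wnorm v (Vop g f)) (Rbar_mult 1 (wnorm v (Top g f))).
Proof.
intros Hf. apply wnorm_le_mult; [lra | exact v_pos |]. intros N HN H. rewrite Rmult_1_l.
apply Vop_le_Top, H.
Qed.

Lemma norm_Top_le_w (f : C -> C) : analytic f ->
  Rbar_le (wnorm v (Top g f)) (Rbar_mult K_w (wnorm w f)).
Proof.
intros Hf. apply wnorm_le_mult; [exact K_w_pos | exact w_pos |]. intros N HN H.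
apply Top_le_w; auto. now apply analytic_cdiff.
Qed.

Lemma norm_w_le_Vop (f : C -> C) : analytic f ->
  Rbar_le (wnorm w f) (Rbar_mult K_V (wnorm v (Vop g f))).
Proof.
intros Hf. apply wnorm_le_mult; [exact K_V_pos | exact v_pos |]. intros N HN H.
apply w_le_Vop; auto. now apply analytic_cdiff.
Qed.

Lemma Rbar_mult_le_trans (x y z : Rbar) (K L : R) : 0 < K -> 0 < L ->
  Rbar_le 0 y -> Rbar_le 0 z ->
  Rbar_le x (Rbar_mult K y) -> Rbar_le y (Rbar_mult L z) -> Rbar_le x (Rbar_mult (K * L) z).
Proof.
intros HK HL Hy Hz Hxy Hyz.
assert (Hinf : forall A, 0 < A -> Rbar_mult A p_infty = p_infty).
{ intros A HA. unfold Rbar_mult, Rbar_mult'. destruct (Rle_dec 0 A) as [HA'|]; [|lra].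
  destruct (Rle_lt_or_eq_dec 0 A HA'); [reflexivity|lra]. }
destruct z as [z| |]; [|rewrite Hinf by nra; now destruct x|easy].
destruct y as [y| |]; [|easy|easy]. destruct x as [x| |]; simpl in *; try easy.
apply Rle_trans with (1 := Hxy). rewrite Rmult_assoc. apply Rmult_le_compat_l; lra.
Qed.

Section Spaces.
Variables (X : (R -> R) -> fspace).
Hypothesis X_norm : forall u, fnorm (X u) = wnorm u.
Hypothesis X_analytic : forall u f, X u f -> analytic f.
Hypothesis X_V_T : forall f, analytic f -> X v (Vop g f) <-> X v (Top g f).
Hypothesis X_V_w : forall f, analytic f -> X v (Vop g f) <-> X w f.

(** [Hinf] and [Hzero] share their norm and differ only in membership, which is therefore a
    parameter. Three inequalities form a cycle, from [V_g f] to [T_g f] to [f] under [w] and back to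
    [V_g f]; each equivalence composes the arcs of this cycle. *)
Lemma optimal_domains_agree :
  same_space_equiv_norms (optimal_domain (Vop g) (X v)) (optimal_domain (Top g) (X v)) /\
  same_space_equiv_norms (optimal_domain (Top g) (X v)) (X w) /\
  same_space_equiv_norms (optimal_domain (Vop g) (X v)) (X w).
Proof.
assert (P := wnorm_ge_0 v). assert (Pw := wnorm_ge_0 w).
assert (Kw := K_w_pos). assert (KV := K_V_pos).
assert (KK : 0 < K_w * K_V) by nra.
refine (conj (conj _ _) (conj (conj _ _) (conj _ _))).
- intros f. split; intros [Hf H]; (split; [exact Hf|]); now apply X_V_T.
- apply (equivalent_norms_intro _ _ (K_w * K_V) 1); [exact KK|lra|].
  intros f [Hf _]. simpl. rewrite X_norm. split; [apply P, v_pos|]. split; [apply P, v_pos|]. split.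
  + apply Rbar_mult_le_trans with (wnorm w f); auto using v_pos, w_pos, norm_Top_le_w, norm_w_le_Vop.
  + now apply norm_Vop_le_Top.
- intros f. split.
  + intros [Hf H]. now apply X_V_w, X_V_T.
  + intros H. assert (Hf := X_analytic _ _ H). split; [exact Hf|]. now apply X_V_T, X_V_w.
- apply (equivalent_norms_intro _ _ (K_V * 1) K_w); [lra|exact Kw|].
  intros f [Hf _]. simpl. rewrite !X_norm. split; [apply P, v_pos|]. split; [apply Pw, w_pos|]. split.
  + apply Rbar_mult_le_trans with (wnorm v (Vop g f)); auto using v_pos, norm_Vop_le_Top, norm_w_le_Vop.
    lra.
  + now apply norm_Top_le_w.
- intros f. split.
  + intros [Hf H]. now apply X_V_w.
  + intros H. assert (Hf := X_analytic _ _ H). split; [exact Hf|]. now apply X_V_w.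
- apply (equivalent_norms_intro _ _ K_V (1 * K_w)); [exact KV|lra|].
  intros f [Hf _]. simpl. rewrite !X_norm. split; [apply P, v_pos|]. split; [apply Pw, w_pos|]. split.
  + now apply norm_w_le_Vop.
  + apply Rbar_mult_le_trans with (wnorm v (Top g f)); auto using v_pos, w_pos, norm_Vop_le_Top, norm_Top_le_w.
    lra.
Qed.
End Spaces.

Lemma optimal_domains_Hinf :
  same_space_equiv_norms (optimal_domain (Vop g) (Hinf v)) (optimal_domain (Top g) (Hinf v)) /\
  same_space_equiv_norms (optimal_domain (Top g) (Hinf v)) (Hinf w) /\
  same_space_equiv_norms (optimal_domain (Vop g) (Hinf v)) (Hinf w).
Proof.
assert (HVw : forall f, analytic f -> Hinf v (Vop g f) -> Hinf w f).
{ intros f Hf [_ H]. split; [exact Hf|]. apply wnorm_lt_p_infty in H; [|exact v_pos].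
  destruct H as [N [HN H]]. apply wnorm_lt_p_infty; [exact w_pos|].
  exists (M2 * (32 * c1 * 2 ^ m) * N). split.
  - apply Rmult_le_pos; [left; exact K_V_pos|exact HN].
  - apply w_le_Vop; [now apply analytic_cdiff|exact H]. }
assert (HwT : forall f, analytic f -> Hinf w f -> Hinf v (Top g f)).
{ intros f Hf [_ H]. assert (Hd := proj1 (analytic_cdiff f) Hf).
  split; [apply analytic_cdiff; now apply Top_cdiff|].
  apply wnorm_lt_p_infty in H; [|exact w_pos].
  destruct H as [N [HN H]]. apply wnorm_lt_p_infty; [exact v_pos|].
  exists (2 * M1 * (c2 / b + 1) * N). split.
  - apply Rmult_le_pos; [left; exact K_w_pos|exact HN].
  - now apply Top_le_w. }
assert (HTV : forall f, analytic f -> Hinf v (Top g f) -> Hinf v (Vop g f)).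
{ intros f Hf [_ H]. assert (Hd := proj1 (analytic_cdiff f) Hf).
  split; [apply analytic_cdiff; now apply Vop_cdiff|].
  apply wnorm_lt_p_infty in H; [|exact v_pos].
  destruct H as [N [HN H]]. apply wnorm_lt_p_infty; [exact v_pos|].
  exists N. split; [exact HN|]. now apply Vop_le_Top. }
apply (optimal_domains_agree Hinf); auto.
- now intros u f [Hf _].
- intros f Hf. split; auto.
- intros f Hf. split; auto.
Qed.

Lemma optimal_domains_Hzero : filterlim v (at_left 1) (locally 0) ->
  same_space_equiv_norms (optimal_domain (Vop g) (Hzero v)) (optimal_domain (Top g) (Hzero v)) /\
  same_space_equiv_norms (optimal_domain (Top g) (Hzero v)) (Hzero w) /\
  same_space_equiv_norms (optimal_domain (Vop g) (Hzero v)) (Hzero w).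
Proof.
intros Hlim.
apply (optimal_domains_agree Hzero); auto.
- now intros u f [Hf _].
- intros f Hf. assert (Hd := proj1 (analytic_cdiff f) Hf). split; intros [_ H]; split.
  + apply analytic_cdiff; now apply Top_cdiff.
  + now apply vanishing_Vop_Top.
  + apply analytic_cdiff; now apply Vop_cdiff.
  + now apply vanishing_Vop_Top.
- intros f Hf. assert (Hd := proj1 (analytic_cdiff f) Hf). split; intros [_ H]; split.
  + exact Hf.
  + now apply vanishing_Vop_w.
  + apply analytic_cdiff; now apply Vop_cdiff.
  + now apply vanishing_w_Vop.
Qed.
End Operators.

(** * A lacunary series *)

(** The inequality [y <= exp y] at [y = x / (p + 1)] is raised to the power [p]. Dividing by [p + 1]
    rather than [p] covers [p = 0]. *)
Lemma pow_mult_exp_le (p : nat) (x : R) : 0 <= x -> x ^ p * exp (- x) <= INR (S p) ^ p.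
Proof.
intros Hx.
assert (Hp : 0 < INR (S p)) by (apply lt_0_INR; lia).
assert (H1 : x / INR (S p) <= exp (x / INR (S p))).
{ assert (K := exp_ineq1_le (x / INR (S p))). lra. }
assert (H0 : 0 <= x / INR (S p)) by now apply Rdiv_le_0_compat.
assert (H2 : (x / INR (S p)) ^ p <= exp x).
{ apply Rle_trans with (exp (x / INR (S p)) ^ p); [now apply pow_incr|].
  rewrite <- Rpower_pow by apply exp_pos. unfold Rpower. rewrite ln_exp.
  assert (E : INR p * (x / INR (S p)) <= x).
  { rewrite S_INR in *. apply (Rmult_le_reg_r (INR p + 1)); auto.
    replace (INR p * (x / (INR p + 1)) * (INR p + 1)) with (INR p * x) by (field; lra). lra. }
  destruct E as [E|E]; [left; now apply exp_increasing|right; now rewrite E]. }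
unfold Rdiv in H2. rewrite Rpow_mult_distr, pow_inv in H2.
assert (Hpp : 0 < INR (S p) ^ p) by now apply pow_lt.
assert (He := exp_pos x). rewrite exp_Ropp.
apply (Rmult_le_reg_r (exp x)); auto. rewrite Rmult_assoc, Rinv_l, Rmult_1_r by lra.
apply (Rmult_le_reg_r (/ INR (S p) ^ p)); [now apply Rinv_0_lt_compat|].
replace (INR (S p) ^ p * exp x * / INR (S p) ^ p) with (exp x) by (field; lra). exact H2.
Qed.

Lemma pow_le_exp (r : R) (n : nat) : 0 <= r -> r ^ n <= exp (- ((1 - r) * INR n)).
Proof.
intros Hr.
replace (- ((1 - r) * INR n)) with (INR n * (r - 1)) by ring.
apply Rle_trans with (exp (r - 1) ^ n).
- apply pow_incr. split; [exact Hr|]. assert (K := exp_ineq1_le (r - 1)). lra.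
- rewrite <- Rpower_pow by apply exp_pos. unfold Rpower. rewrite ln_exp. lra.
Qed.

Lemma bernoulli_le (x : R) (n : nat) : 0 <= x <= 1 -> 1 - INR n * x <= (1 - x) ^ n.
Proof.
intros Hx. induction n as [|n IH].
- simpl. lra.
- rewrite S_INR. simpl. assert (0 <= (1 - x) ^ n) by (apply pow_le; lra).
  destruct (Rle_lt_dec (1 - INR n * x) 0) as [H1|H1]; [|assert (K := pos_INR n); nra].
  assert (K := pos_INR n). nra.
Qed.

(** * Complex series with a geometric majorant, summed componentwise *)

Definition CSeries (c : nat -> C) : C :=
  (Series (fun k => Re (c k)), Series (fun k => Im (c k))).

(** [Series] is total, so the algebraic rules for [CSeries] need convergence; this single condition
    supplies it for both components, together with a bound. *)
Definition geometric (c : nat -> C) (B : R) : Prop := forall k, Cmod (c k) <= B * (/ 2) ^ k.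

Lemma ex_series_half (B : R) : ex_series (fun k => B * (/ 2) ^ k).
Proof.
apply (ex_series_scal (V := R_NormedModule) B (fun n => (/ 2) ^ n)).
apply ex_series_geom. rewrite Rabs_pos_eq; lra.
Qed.

Lemma Series_half (B : R) : Series (fun k => B * (/ 2) ^ k) = 2 * B.
Proof.
rewrite Series_scal_l, Series_geom by (rewrite Rabs_pos_eq; lra). field.
Qed.

Lemma geometric_real (a : nat -> R) (B : R) : (forall k, Rabs (a k) <= B * (/ 2) ^ k) ->
  ex_series a /\ Rabs (Series a) <= 2 * B.
Proof.
intros H.
assert (Ha : ex_series (fun k => Rabs (a k))).
{ apply (ex_series_le (K := R_AbsRing) (V := R_CompleteNormedModule) _ (fun k => B * (/ 2) ^ k)).
  - intros k. change (Rabs (Rabs (a k)) <= B * (/ 2) ^ k). now rewrite Rabs_Rabsolu.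
  - apply ex_series_half. }
split; [now apply ex_series_Rabs|].
apply Rle_trans with (1 := Series_Rabs a Ha).
rewrite <- Series_half. apply Series_le; [|apply ex_series_half].
intros k. split; [apply Rabs_pos|apply H].
Qed.

Lemma geometric_Re (c : nat -> C) (B : R) : geometric c B ->
  ex_series (fun k => Re (c k)) /\ Rabs (Series (fun k => Re (c k))) <= 2 * B.
Proof. intros H. apply geometric_real. intros k. apply Rle_trans with (2 := H k), re_le_Cmod. Qed.

Lemma geometric_Im (c : nat -> C) (B : R) : geometric c B ->
  ex_series (fun k => Im (c k)) /\ Rabs (Series (fun k => Im (c k))) <= 2 * B.
Proof.
intros H. apply geometric_real. intros k. apply Rle_trans with (2 := H k).
apply Rle_trans with (2 := Rmax_Cmod _), Rmax_r.
Qed.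

Lemma Cmod_CSeries (c : nat -> C) (B : R) : geometric c B -> Cmod (CSeries c) <= 4 * B.
Proof.
intros H. destruct (geometric_Re c B H) as [_ H1]. destruct (geometric_Im c B H) as [_ H2].
apply Rle_trans with (1 := Cmod_le_Rabs _ _). lra.
Qed.

Lemma CSeries_minus (c d : nat -> C) (B B' : R) : geometric c B -> geometric d B' ->
  CSeries (fun k => c k - d k)%C = (CSeries c - CSeries d)%C.
Proof.
intros Hc Hd. destruct (geometric_Re c B Hc) as [H1 _]. destruct (geometric_Im c B Hc) as [H2 _].
destruct (geometric_Re d B' Hd) as [H3 _]. destruct (geometric_Im d B' Hd) as [H4 _].
unfold CSeries, Cminus, Cplus, Copp; simpl.
change (fst) with Re. change (snd) with Im.
f_equal; rewrite <- Series_opp, <- Series_plus; try reflexivity; auto;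
 now apply (ex_series_opp (V := R_NormedModule)).
Qed.

Lemma CSeries_mult_r (c : nat -> C) (u : C) (B : R) : geometric c B ->
  CSeries (fun k => c k * u)%C = (CSeries c * u)%C.
Proof.
intros Hc. destruct (geometric_Re c B Hc) as [H1 _]. destruct (geometric_Im c B Hc) as [H2 _].
unfold CSeries, Cmult; simpl.
rewrite <- !Series_scal_r.
f_equal; [rewrite <- Series_minus | rewrite <- Series_plus]; try reflexivity;
 now apply ex_series_scal_r.
Qed.

Lemma Series_ge_term (a : nat -> R) (j : nat) : (forall k, 0 <= a k) -> ex_series a ->
  a j <= Series a.
Proof.
intros Ha Hex. revert a Ha Hex.
assert (Hpos : forall a : nat -> R, (forall k, 0 <= a k) -> ex_series a -> 0 <= Series a).
{ intros a Ha Hex. replace 0 with (Series (fun k => 0 * a k)) by (rewrite Series_scal_l; ring).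
  apply Series_le; [|exact Hex]. intros k. specialize (Ha k). lra. }
induction j as [|j IH]; intros a Ha Hex; rewrite Series_incr_1 by exact Hex;
apply ex_series_incr_1 in Hex.
- assert (K := Hpos (fun k => a (S k)) (fun k => Ha (S k)) Hex). lra.
- assert (K := IH (fun k => a (S k)) (fun k => Ha (S k)) Hex). specialize (Ha O). simpl in K. lra.
Qed.

(** The remainder at [n + 1] is [u] times the remainder at [n] plus [n z^(n-1) (u - z)^2]. The
    factor [rho * rho] on the left avoids the exponent [n - 2], and the crude [n^2] closes the
    induction by [n^2 + n <= (n + 1)^2]. *)
Lemma Cpow_taylor_le (n : nat) (z u : C) (rho : R) : Cmod z <= rho -> Cmod u <= rho ->
  rho * rho * Cmod (u ^ n - z ^ n - INR n * z ^ pred n * (u - z))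
  <= INR n * INR n * rho ^ n * (Cmod (u - z) * Cmod (u - z)).
Proof.
intros Hz Hu. assert (Hr : 0 <= rho) by (apply Rle_trans with (2 := Hz), Cmod_ge_0).
set (d := Cmod (u - z)). assert (Hd : 0 <= d) by apply Cmod_ge_0.
induction n as [|n IH].
- simpl pow. replace (u ^ 0 - z ^ 0 - INR 0 * z ^ pred 0 * (u - z))%C with (RtoC 0) by (simpl; ring).
  rewrite Cmod_0. simpl. lra.
- replace (u ^ S n - z ^ S n - INR (S n) * z ^ pred (S n) * (u - z))%C
    with (u * (u ^ n - z ^ n - INR n * z ^ pred n * (u - z)) + INR n * z ^ pred n * ((u - z) * (u - z)))%C.
  2: { rewrite S_INR, RtoC_plus, !Cpow_S. destruct n as [|n]; simpl pred.
       - simpl INR. simpl Cpow. ring.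
       - rewrite !Cpow_S. ring. }
  set (D := Cmod (u ^ n - z ^ n - INR n * z ^ pred n * (u - z))) in *.
  assert (T : Cmod (u * (u ^ n - z ^ n - INR n * z ^ pred n * (u - z)) + INR n * z ^ pred n * ((u - z) * (u - z)))
    <= rho * D + INR n * rho ^ pred n * (d * d)).
  { apply Rle_trans with (1 := Cmod_triangle _ _). rewrite !Cmod_mult, Cmod_pow, Cmod_R.
    rewrite Rabs_pos_eq by apply pos_INR. fold d. apply Rplus_le_compat.
    - apply Rmult_le_compat_r; [apply Cmod_ge_0|exact Hu].
    - apply Rmult_le_compat_r; [nra|]. apply Rmult_le_compat_l; [apply pos_INR|].
      apply pow_incr. split; [apply Cmod_ge_0|exact Hz]. }
  apply Rle_trans with (rho * rho * (rho * D + INR n * rho ^ pred n * (d * d))).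
  { apply Rmult_le_compat_l; [nra|exact T]. }
  assert (E : rho * rho * (INR n * rho ^ pred n * (d * d)) = INR n * rho ^ S n * (d * d)).
  { destruct n as [|n]; simpl pred; [simpl; ring|]. simpl pow. ring. }
  apply Rle_trans with (rho * (INR n * INR n * rho ^ n * (d * d)) + INR n * rho ^ S n * (d * d)).
  + rewrite Rmult_plus_distr_l, E. apply Rplus_le_compat_r.
    replace (rho * rho * (rho * D)) with (rho * (rho * rho * D)) by ring.
    now apply Rmult_le_compat_l.
  + rewrite S_INR. simpl pow.
    assert (P : 0 <= rho * rho ^ n * (d * d)).
    { repeat apply Rmult_le_pos; auto. now apply pow_le. }
    assert (Q := pos_INR n). nra.
Qed.

Section Lacunary.
Variables (v : R -> R) (c : R) (m : nat).
Hypothesis v_weight : weight v.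
Hypothesis c_pos : 0 < c.
Hypothesis v_pow : forall s r, 0 <= s -> s <= r -> r < 1 ->
  v s * (1 - r) ^ m <= c * v r * (1 - s) ^ m.

(** The factor 2 gives [rad k >= 1/2], and lets [16 ^ k] serve as half the exponent in the lower
    bound at [rad k]. *)
Let N (k : nat) : nat := (2 * 16 ^ k)%nat.
Let rad (k : nat) : R := 1 - / INR (N k).
Let coef (k : nat) : R := 2 ^ k / v (rad k).

Lemma INR_N (k : nat) : INR (N k) = 2 * (4 ^ k * 4 ^ k).
Proof.
unfold N. rewrite mult_INR, pow_INR, <- Rpow_mult_distr. f_equal. f_equal. simpl. lra.
Qed.

Lemma pow_2_le_INR_N (k : nat) : 2 ^ k <= INR (N k).
Proof.
rewrite INR_N. assert (1 <= 4 ^ k) by (apply pow_R1_Rle; lra).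
assert (2 ^ k <= 4 ^ k) by (apply pow_incr; lra). nra.
Qed.

Lemma INR_N_ge_2 (k : nat) : 2 <= INR (N k).
Proof.
rewrite INR_N. assert (1 <= 4 ^ k) by (apply pow_R1_Rle; lra). nra.
Qed.

Lemma rad_bounds (k : nat) : / 2 <= rad k < 1.
Proof.
assert (K := INR_N_ge_2 k). unfold rad.
assert (0 < / INR (N k)) by (apply Rinv_0_lt_compat; lra).
assert (/ INR (N k) <= / 2) by (apply Rinv_le_contravar; lra). lra.
Qed.

Lemma v_rad_pos (k : nat) : 0 < v (rad k).
Proof. apply v_weight. assert (K := rad_bounds k). lra. Qed.

Lemma coef_pos (k : nat) : 0 < coef k.
Proof. apply Rdiv_lt_0_compat; [apply pow_lt; lra|apply v_rad_pos]. Qed.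

(** Comparing [v] at [0] and at [rad k], where [1 - rad k = 1 / N k], shows that the coefficients
    grow at most polynomially in the exponents. *)
Lemma coef_le (k : nat) : coef k <= c / v 0 * INR (N k) ^ S m.
Proof.
assert (Hr := rad_bounds k). assert (Hv := v_rad_pos k).
assert (Hv0 : 0 < v 0) by (apply v_weight; lra).
assert (K := v_pow 0 (rad k) ltac:(lra) ltac:(lra) ltac:(lra)).
rewrite Rminus_0_r, pow1, Rmult_1_r in K.
replace (1 - rad k) with (/ INR (N k)) in K by (unfold rad; ring).
assert (HN := INR_N_ge_2 k). rewrite pow_inv in K.
assert (HNm : 0 < INR (N k) ^ m) by (apply pow_lt; lra).
assert (H2 := pow_2_le_INR_N k).
unfold coef. apply (Rmult_le_reg_r (v (rad k))); auto.
replace (2 ^ k / v (rad k) * v (rad k)) with (2 ^ k) by (field; lra).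
apply Rle_trans with (1 := H2). simpl pow.
replace (c / v 0 * (INR (N k) * INR (N k) ^ m) * v (rad k))
  with (INR (N k) * (c * v (rad k) * INR (N k) ^ m / v 0)) by (field; lra).
rewrite <- (Rmult_1_r (INR (N k))) at 1. apply Rmult_le_compat_l; [lra|].
apply (Rmult_le_reg_r (v 0 * / INR (N k) ^ m)).
{ apply Rmult_lt_0_compat; auto. now apply Rinv_0_lt_compat. }
replace (c * v (rad k) * INR (N k) ^ m / v 0 * (v 0 * / INR (N k) ^ m))
  with (c * v (rad k)) by (field; lra). lra.
Qed.

(** Exponential decay of [rho ^ N k] beats any power of [N k]. The factor [N k] squared is room for
    the second-order remainder in termwise differentiation. *)
Lemma coef_summable (rho : R) : 0 <= rho < 1 -> exists B, 0 <= B /\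
  forall k, coef k * (INR (N k) * INR (N k)) * rho ^ N k <= B * (/ 2) ^ k.
Proof.
intros Hrho. set (p := (m + 4)%nat).
assert (Hv0 : 0 < v 0) by (apply v_weight; lra).
assert (Hp : 0 < (1 - rho) ^ p) by (apply pow_lt; lra).
assert (HSp : 0 <= INR (S p) ^ p) by (apply pow_le, pos_INR).
set (Q := c / v 0). assert (HQ : 0 <= Q) by (apply Rdiv_le_0_compat; lra).
exists (Q * (INR (S p) ^ p / (1 - rho) ^ p)).
split. { apply Rmult_le_pos; auto. now apply Rdiv_le_0_compat. }
intros k. set (n := INR (N k)).
assert (Hn : 2 <= n) by apply INR_N_ge_2.
assert (Hn2 : (/ 2) ^ k >= / n).
{ rewrite pow_inv. apply Rle_ge, Rinv_le_contravar; [apply pow_lt; lra|apply pow_2_le_INR_N]. }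
assert (He := pow_mult_exp_le p ((1 - rho) * n) ltac:(nra)).
assert (Hexp := pow_le_exp rho (N k) (proj1 Hrho)). fold n in Hexp.
assert (Hrn : 0 <= rho ^ N k) by (apply pow_le; lra).
assert (Hnp : 0 < n ^ p) by (apply pow_lt; lra).
rewrite Rpow_mult_distr in He.
assert (H1 : n ^ p * rho ^ N k <= INR (S p) ^ p / (1 - rho) ^ p).
{ apply (Rmult_le_reg_l ((1 - rho) ^ p)); auto.
  replace ((1 - rho) ^ p * (INR (S p) ^ p / (1 - rho) ^ p)) with (INR (S p) ^ p) by (field; lra).
  apply Rle_trans with (2 := He). rewrite <- Rmult_assoc. apply Rmult_le_compat_l; [|exact Hexp].
  apply Rmult_le_pos; lra. }
apply Rle_trans with (Q * n ^ S m * (n * n) * rho ^ N k).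
{ apply Rmult_le_compat_r; auto. apply Rmult_le_compat_r; [nra|]. apply coef_le. }
replace (Q * n ^ S m * (n * n) * rho ^ N k) with (Q * (n ^ p * rho ^ N k) * / n).
2: { unfold p. rewrite pow_add. simpl pow. field. lra. }
apply Rmult_le_compat; try lra.
- apply Rmult_le_pos; auto. apply Rmult_le_pos; lra.
- left. apply Rinv_0_lt_compat. lra.
- apply Rmult_le_compat_l; auto.
Qed.

Definition lacunary (z : C) : C := CSeries (fun k => coef k * z ^ N k)%C.

Lemma lacunary_geometric (z : C) : in_disc z ->
  exists B, geometric (fun k => coef k * z ^ N k)%C B.
Proof.
intros Hz. destruct (coef_summable (Cmod z) (conj (Cmod_ge_0 z) Hz)) as [B [HB H]].
exists B. intros k. apply Rle_trans with (2 := H k).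
assert (Hc := coef_pos k). assert (Hn := INR_N_ge_2 k).
rewrite Cmod_scal_R, Cmod_pow by lra.
apply Rmult_le_compat_r; [apply pow_le, Cmod_ge_0|].
assert (1 <= INR (N k) * INR (N k)) by nra. nra.
Qed.

(** Summing the second-order remainders of the powers on [|u| <= rho] gives a total error
    [4 B |u - z|^2 / rho^2]. *)
Lemma lacunary_cdiff (z : C) : in_disc z -> cdiff lacunary z.
Proof.
intros Hz. unfold in_disc in Hz. assert (Hz0 := Cmod_ge_0 z).
set (rho := (1 + Cmod z) / 2). assert (Hrho : 0 < rho < 1) by (unfold rho; lra).
destruct (coef_summable rho ltac:(lra)) as [B [HB H]].
exists (CSeries (fun k => coef k * (INR (N k) * z ^ pred (N k)))%C).
intros eps Heps.
set (d := Rmin (rho - Cmod z) (eps * (rho * rho) / (4 * B + 1))).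
assert (Hrr : 0 < rho * rho) by nra.
exists d. split.
{ apply Rmin_glb_lt; [unfold rho; lra|]. apply Rdiv_lt_0_compat; nra. }
intros u Hu. assert (Hu1 := Rlt_le_trans _ _ _ Hu (Rmin_l _ _)). assert (Hu2 := Rlt_le_trans _ _ _ Hu (Rmin_r _ _)).
assert (Huz := Cmod_ge_0 (u - z)).
assert (Bu : Cmod u <= rho).
{ replace u with ((u - z) + z)%C by ring. apply Rle_trans with (1 := Cmod_triangle _ _). lra. }
assert (Bz : Cmod z <= rho) by (unfold rho; lra).
destruct (lacunary_geometric u) as [Bu' Gu]; [unfold in_disc; lra|].
destruct (lacunary_geometric z) as [Bz' Gz]; [exact Hz|].
assert (Gd : geometric (fun k => coef k * (INR (N k) * z ^ pred (N k)))%C (B / rho)).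
{ intros k. assert (Hc := coef_pos k). assert (Hn := INR_N_ge_2 k).
  rewrite Cmod_scal_R, Cmod_scal_R, Cmod_pow by lra.
  apply Rle_trans with (coef k * (INR (N k) * rho ^ pred (N k))).
  { apply Rmult_le_compat_l; [lra|]. apply Rmult_le_compat_l; [lra|]. apply pow_incr; lra. }
  apply (Rmult_le_reg_r rho); [lra|].
  replace (B / rho * (/ 2) ^ k * rho) with (B * (/ 2) ^ k) by (field; lra).
  apply Rle_trans with (2 := H k).
  assert (E : rho ^ N k = rho * rho ^ pred (N k)).
  { destruct (N k) as [|n]; [simpl in Hn; lra|reflexivity]. }
  assert (P : 0 < rho ^ N k) by (apply pow_lt; lra).
  replace (coef k * (INR (N k) * rho ^ pred (N k)) * rho) with (coef k * INR (N k) * rho ^ N k) by (rewrite E; ring).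
  apply Rmult_le_compat_r; [lra|]. apply Rmult_le_compat_l; [lra|]. nra. }
unfold lacunary.
rewrite <- (CSeries_minus _ _ _ _ Gu Gz), <- (CSeries_mult_r _ (u - z)%C _ Gd).
set (q := Cmod (u - z)) in *.
assert (Gm : geometric (fun k => coef k * u ^ N k - coef k * z ^ N k)%C (Bu' + Bz')).
{ intros k. unfold Cminus. apply Rle_trans with (1 := Cmod_triangle _ _). rewrite Cmod_opp.
  specialize (Gu k). specialize (Gz k). simpl in Gu, Gz. lra. }
assert (Gp : geometric (fun k => coef k * (INR (N k) * z ^ pred (N k)) * (u - z))%C (B / rho * q)).
{ intros k. rewrite Cmod_mult. fold q. specialize (Gd k). simpl in Gd.
  replace (B / rho * q * (/ 2) ^ k) with (B / rho * (/ 2) ^ k * q) by ring. now apply Rmult_le_compat_r. }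
rewrite <- (CSeries_minus _ _ _ _ Gm Gp).
apply Rle_trans with (4 * (B * (q * q) / (rho * rho))).
- apply Cmod_CSeries. intros k.
  assert (Hc := coef_pos k).
  replace (coef k * u ^ N k - coef k * z ^ N k - coef k * (INR (N k) * z ^ pred (N k)) * (u - z))%C
    with (coef k * (u ^ N k - z ^ N k - INR (N k) * z ^ pred (N k) * (u - z)))%C by ring.
  rewrite Cmod_scal_R by lra.
  assert (T := Cpow_taylor_le (N k) z u rho Bz Bu). fold q in T.
  set (D := Cmod (u ^ N k - z ^ N k - INR (N k) * z ^ pred (N k) * (u - z))) in *.
  apply (Rmult_le_reg_r (rho * rho)); auto.
  replace (B * (q * q) / (rho * rho) * (/ 2) ^ k * (rho * rho)) with (B * (/ 2) ^ k * (q * q)) by (field; lra).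
  apply Rle_trans with (coef k * (INR (N k) * INR (N k)) * rho ^ N k * (q * q)).
  + replace (coef k * D * (rho * rho)) with (coef k * (rho * rho * D)) by ring.
    replace (coef k * (INR (N k) * INR (N k)) * rho ^ N k * (q * q))
      with (coef k * (INR (N k) * INR (N k) * rho ^ N k * (q * q))) by ring.
    apply Rmult_le_compat_l; lra.
  + apply Rmult_le_compat_r; [nra|apply H].
- apply Rle_trans with (4 * B * (eps * (rho * rho) / (4 * B + 1)) * q / (rho * rho)).
  + replace (4 * (B * (q * q) / (rho * rho))) with (4 * B * q * q / (rho * rho)) by (field; lra).
    unfold Rdiv at 1 2. apply Rmult_le_compat_r; [left; now apply Rinv_0_lt_compat|].
    apply Rmult_le_compat_r; auto. apply Rmult_le_compat_l; [lra|]. apply Rlt_le, Hu2.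
  + replace (4 * B * (eps * (rho * rho) / (4 * B + 1)) * q / (rho * rho))
      with (eps * q * (4 * B / (4 * B + 1))) by (field; lra).
    rewrite <- (Rmult_1_r (eps * q)) at 2. apply Rmult_le_compat_l; [nra|].
    apply (Rmult_le_reg_r (4 * B + 1)); [lra|]. unfold Rdiv. rewrite Rmult_assoc, Rinv_l; lra.
Qed.

(** Write [1 - r] as [q * q]. One [q] remains in the bound; the other has to supply [4^(-k)], which
    turns [2^k] into [2^(-k)]. For [r >= rad k] it does so directly, as [1 - r <= 1 / N k].
    Otherwise [q] and [v r / v (rad k)] are bounded by powers of [x = (1 - r) N k], absorbed by
    [r ^ N k <= exp (- x)]. *)
Lemma term_weight_le (k : nat) (r : R) : 0 <= r < 1 ->
  coef k * r ^ N k * ((1 - r) * v r)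
  <= (1 + c * INR (S (S m)) ^ S m) * sqrt (1 - r) * (/ 2) ^ k.
Proof.
intros Hr. assert (HR := rad_bounds k). assert (HvR := v_rad_pos k).
assert (Hv : 0 < v r) by now apply v_weight.
assert (Hn := INR_N_ge_2 k). set (n := INR (N k)) in *.
assert (En : n = 2 * (4 ^ k * 4 ^ k)) by apply INR_N.
assert (H4 : 0 < 4 ^ k) by (apply pow_lt; lra).
assert (H2 : 0 < 2 ^ k) by (apply pow_lt; lra).
assert (E2 : (/ 2) ^ k = 2 ^ k * / 4 ^ k).
{ replace 4 with (2 * 2) by ring. rewrite Rpow_mult_distr, pow_inv. field. lra. }
assert (Hrn : 0 <= r ^ N k <= 1).
{ split; [apply pow_le; lra|]. rewrite <- (pow1 (N k)). apply pow_incr; lra. }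
set (K := c * INR (S (S m)) ^ S m).
assert (HK : 0 <= K). { unfold K. apply Rmult_le_pos; [lra|]. apply pow_le, pos_INR. }
set (q := sqrt (1 - r)). assert (Hq : 0 < q) by (apply sqrt_lt_R0; lra).
assert (Eq : q * q = 1 - r) by (apply sqrt_sqrt; lra).
assert (Hi4 : 0 < / 4 ^ k) by now apply Rinv_0_lt_compat.
assert (Main : r ^ N k * (q * v r) <= (1 + K) * / 4 ^ k * v (rad k)).
{ destruct (Rle_lt_dec (rad k) r) as [Hfar|Hnear].
  - assert (Hvr : v r <= v (rad k)) by (apply v_weight; lra).
    assert (Hqn : q <= / 4 ^ k).
    { apply Rsqr_incr_0; unfold Rsqr; try lra. rewrite Eq, <- Rinv_mult.
      apply Rle_trans with (/ n); [unfold rad in Hfar; fold n in Hfar; lra|].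
      apply Rinv_le_contravar; [nra|]. rewrite En. nra. }
    apply Rle_trans with (1 * (/ 4 ^ k * v (rad k))).
    + apply Rmult_le_compat; try lra; [nra|]. apply Rmult_le_compat; lra.
    + rewrite <- Rmult_assoc. apply Rmult_le_compat_r; [lra|]. apply Rmult_le_compat_r; lra.
  - set (x := (1 - r) * n).
    assert (Hx : 1 <= x).
    { unfold x. unfold rad in Hnear. fold n in Hnear.
      apply (Rmult_le_reg_r (/ n)); [apply Rinv_0_lt_compat; lra|].
      rewrite Rmult_assoc, Rinv_r; lra. }
    (* Since [N k] is twice [16 ^ k], the square of the right-hand side is [(1 - r) * (2 * x)], and
       [x >= 1]. *)
    assert (Hqx : q <= x * / 4 ^ k).
    { apply Rsqr_incr_0; unfold Rsqr; try lra.
      - rewrite Eq. replace (x * / 4 ^ k * (x * / 4 ^ k)) with ((1 - r) * (2 * x)).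
        + nra.
        + unfold x at 2. rewrite En in *. unfold x. rewrite En. field. lra.
      - apply Rmult_le_pos; lra. }
    assert (Hvx : v r <= c * v (rad k) * x ^ m).
    { assert (P := v_pow r (rad k) (proj1 Hr) ltac:(lra) ltac:(lra)).
      replace (1 - rad k) with (/ n) in P by (unfold rad; fold n; ring).
      unfold x. rewrite Rpow_mult_distr. rewrite pow_inv in P.
      assert (Hnm : 0 < n ^ m) by (apply pow_lt; lra).
      apply (Rmult_le_reg_r (/ n ^ m)); [now apply Rinv_0_lt_compat|].
      replace (c * v (rad k) * ((1 - r) ^ m * n ^ m) * / n ^ m) with (c * v (rad k) * (1 - r) ^ m) by (field; lra).
      exact P. }
    assert (Hexp := pow_le_exp r (N k) (proj1 Hr)). fold n in Hexp. fold x in Hexp.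
    assert (He := pow_mult_exp_le (S m) x ltac:(lra)).
    assert (Hxm : 0 < x ^ m) by (apply pow_lt; lra).
    apply Rle_trans with (exp (- x) * (x * / 4 ^ k * (c * v (rad k) * x ^ m))).
    + apply Rmult_le_compat; try lra; [nra|]. apply Rmult_le_compat; lra.
    + replace (exp (- x) * (x * / 4 ^ k * (c * v (rad k) * x ^ m)))
        with (c * (x ^ S m * exp (- x)) * (/ 4 ^ k * v (rad k))) by (simpl pow; ring).
      rewrite (Rmult_assoc (1 + K)). apply Rmult_le_compat_r; [nra|].
      apply Rle_trans with K; [|lra]. apply Rmult_le_compat_l; lra. }
rewrite E2, <- Eq. unfold coef.
replace (2 ^ k / v (rad k) * r ^ N k * (q * q * v r))
  with (2 ^ k * q / v (rad k) * (r ^ N k * (q * v r))) by (field; lra).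
replace ((1 + K) * q * (2 ^ k * / 4 ^ k))
  with (2 ^ k * q / v (rad k) * ((1 + K) * / 4 ^ k * v (rad k))) by (field; lra).
apply Rmult_le_compat_l; [|exact Main].
apply Rdiv_le_0_compat; [nra|exact HvR].
Qed.

Lemma lacunary_vanishing : vanishing (fun r => (1 - r) * v r) lacunary.
Proof.
set (K := 1 + c * INR (S (S m)) ^ S m).
assert (HK : 1 <= K).
{ assert (0 <= c * INR (S (S m)) ^ S m); [|unfold K; lra].
  apply Rmult_le_pos; [lra|]. apply pow_le, pos_INR. }
assert (B : forall z, in_disc z -> Cmod (lacunary z) * ((1 - Cmod z) * v (Cmod z)) <= 4 * (K * sqrt (1 - Cmod z))).
{ intros z Hz. assert (Hr := conj (Cmod_ge_0 z) Hz : 0 <= Cmod z < 1).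
  assert (Hv : 0 < v (Cmod z)) by now apply v_weight.
  assert (Hw : 0 <= (1 - Cmod z) * v (Cmod z)) by nra.
  destruct (lacunary_geometric z Hz) as [B HB].
  set (y := (1 - Cmod z) * v (Cmod z)) in *.
  replace (Cmod (lacunary z) * y) with (Cmod (CSeries (fun k => coef k * z ^ N k * y)%C)).
  - apply Cmod_CSeries. intros k. assert (Hc := coef_pos k).
    rewrite Cmod_mult, Cmod_scal_R, Cmod_pow, Cmod_R, (Rabs_pos_eq y) by lra.
    apply term_weight_le, Hr.
  - rewrite (CSeries_mult_r _ _ B HB), Cmod_mult, Cmod_R, Rabs_pos_eq; auto. }
intros eps Heps. set (e := eps / (4 * K)).
assert (He : 0 < e) by (apply Rdiv_lt_0_compat; lra).
exists (Rmax 0 (1 - e * e)). split.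
- split; [apply Rmax_l|]. apply Rmax_lub_lt; nra.
- intros z Hz. assert (T := Rmax_r 0 (1 - e * e)).
  apply Rle_lt_trans with (1 := B z (proj2 Hz)).
  assert (Hs : sqrt (1 - Cmod z) < e).
  { rewrite <- (sqrt_square e) by lra. apply sqrt_lt_1_alt. lra. }
  replace eps with (4 * (K * e)) by (unfold e; field; lra).
  apply Rmult_lt_compat_l; [lra|]. apply Rmult_lt_compat_l; lra.
Qed.

(** At a positive real point all terms are non-negative, so the sum dominates its [k]-th term. *)
Lemma lacunary_rad (k : nat) : 2 ^ k / 4 <= Cmod (lacunary (rad k)) * v (rad k).
Proof.
assert (HR := rad_bounds k). assert (HvR := v_rad_pos k).
assert (Hz : in_disc (rad k)) by (unfold in_disc; rewrite Cmod_R, Rabs_pos_eq; lra).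
destruct (lacunary_geometric (rad k) Hz) as [B HB].
destruct (geometric_Re _ _ HB) as [Hex _].
assert (E : forall j, Re (coef j * RtoC (rad k) ^ N j)%C = coef j * rad k ^ N j).
{ intros j. rewrite <- RtoC_pow, <- RtoC_mult. reflexivity. }
apply (ex_series_ext _ (fun j => coef j * rad k ^ N j)) in Hex; [|exact E].
assert (T : coef k * rad k ^ N k <= Cmod (lacunary (rad k))).
{ apply Rle_trans with (2 := re_le_Cmod _). apply Rle_trans with (2 := Rle_abs _).
  change (Re (lacunary (rad k))) with (Series (fun j => Re (coef j * RtoC (rad k) ^ N j)%C)).
  rewrite (Series_ext _ _ E). apply (Series_ge_term (fun j => coef j * rad k ^ N j)); [|exact Hex].
  intros j. apply Rmult_le_pos; [left; apply coef_pos|]. apply pow_le. lra. }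
(* Bernoulli at the full exponent gives only [0]; at half of it, [16 ^ k], it gives [1/2], which is
   then squared. *)
assert (H4 : / 4 <= rad k ^ N k).
{ unfold N. rewrite Nat.mul_comm, pow_mult.
  assert (Hb := bernoulli_le (/ INR (N k)) (16 ^ k)).
  assert (Hn := INR_N_ge_2 k).
  assert (Hi : 0 < / INR (N k)) by (apply Rinv_0_lt_compat; lra).
  assert (Hi2 : / INR (N k) <= / 2) by (apply Rinv_le_contravar; lra).
  specialize (Hb ltac:(lra)). fold (rad k) in Hb.
  replace (INR (16 ^ k) * / INR (N k)) with (/ 2) in Hb.
  - assert (Hb' : / 2 <= rad k ^ (16 ^ k)) by lra. simpl pow. nra.
  - unfold N in *. rewrite mult_INR in *. simpl (INR 2) in *. field. lra. }
apply (Rmult_le_compat_r (v (rad k))) in T; [|lra].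
apply Rle_trans with (2 := T). unfold coef.
replace (2 ^ k / v (rad k) * rad k ^ N k * v (rad k)) with (2 ^ k * rad k ^ N k) by (field; lra).
apply Rmult_le_compat_l; [apply pow_le|]; lra.
Qed.

Lemma Hzero_not_Hinf :
  exists f, Hzero (fun r => (1 - r) * v r) f /\ ~ Hinf v f.
Proof.
exists lacunary. split.
- split; [|exact lacunary_vanishing].
  apply analytic_cdiff. exact lacunary_cdiff.
- intros [_ H]. apply wnorm_lt_p_infty in H; [|apply v_weight].
  destruct H as [M [_ H]].
  destruct (Pow_x_infinity 2 ltac:(rewrite Rabs_pos_eq; lra) (4 * M + 1)) as [k Hk].
  specialize (Hk k (le_n k)). rewrite Rabs_pos_eq in Hk by (apply pow_le; lra).
  assert (K := lacunary_rad k). assert (HR := rad_bounds k).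
  assert (HC : Cmod (rad k) = rad k) by (rewrite Cmod_R, Rabs_pos_eq; lra).
  assert (Hz : in_disc (rad k)) by (unfold in_disc; rewrite HC; lra).
  specialize (H _ Hz). rewrite HC in H. lra.
Qed.

Lemma Hinf_sub_Hzero (f : C -> C) : Hinf v f -> Hzero (fun r => (1 - r) * v r) f.
Proof.
intros [Hf H]. split; [exact Hf|].
apply wnorm_lt_p_infty in H; [|apply v_weight]. destruct H as [M [HM H]].
intros eps Heps.
assert (Hd : 0 < eps / (M + 1)) by (apply Rdiv_lt_0_compat; lra).
exists (Rmax 0 (1 - eps / (M + 1))). split.
- split; [apply Rmax_l|]. apply Rmax_lub_lt; lra.
- intros z Hz. assert (T := Rmax_r 0 (1 - eps / (M + 1))).
  specialize (H z (proj2 Hz)).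
  replace (Cmod (f z) * ((1 - Cmod z) * v (Cmod z))) with ((1 - Cmod z) * (Cmod (f z) * v (Cmod z))) by ring.
  apply Rle_lt_trans with ((1 - Cmod z) * M); [apply Rmult_le_compat_l; lra|].
  apply Rle_lt_trans with (eps / (M + 1) * M); [apply Rmult_le_compat_r; lra|].
  apply Rlt_le_trans with (eps / (M + 1) * (M + 1)); [apply Rmult_lt_compat_l; lra|].
  right. field. lra.
Qed.
End Lacunary.

Theorem corollary3p7 (v : R -> R) (g : C -> C)
  (Hv : weight v)
  (Hlc : log_convex v)
  (Hinc : exists alpha r0 : R, 0 < alpha /\ 0 < r0 < 1 /\
     increasing_from r0 (fun r => v r * Rpower (1 - r) (- alpha)))
  (Hdec : exists alpha' r0' : R, 0 < alpha' /\ 0 < r0' < 1 /\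
     decreasing_from r0' (fun r => v r * Rpower (1 - r) (- alpha')))
  (Hg : analytic g)
  (Hg' : bounded_analytic (C_derive g))
  (Hg'inv : inv_bounded_analytic (C_derive g)) :
  let w := fun r : R => (1 - r) * v r in
  (continuous_op (Vop g) (Hinf v) ->
     same_space_equiv_norms (optimal_domain (Vop g) (Hinf v))
                            (optimal_domain (Top g) (Hinf v)) /\
     same_space_equiv_norms (optimal_domain (Top g) (Hinf v)) (Hinf w) /\
     same_space_equiv_norms (optimal_domain (Vop g) (Hinf v)) (Hinf w))
  /\
  (filterlim v (at_left 1) (locally 0) ->
   continuous_op (Vop g) (Hzero v) ->
     same_space_equiv_norms (optimal_domain (Vop g) (Hzero v))
                            (optimal_domain (Top g) (Hzero v)) /\
     same_space_equiv_norms (optimal_domain (Top g) (Hzero v)) (Hzero w) /\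
     same_space_equiv_norms (optimal_domain (Vop g) (Hzero v)) (Hzero w))
  /\
  (filterlim v (at_left 1) (locally 0) ->
   compact_op (Vop g) (Hzero v) ->
     proper_subspace (Hinf v) (optimal_domain (Vop g) (Hzero v)) /\
     same_space (optimal_domain (Vop g) (Hzero v))
                (optimal_domain (Top g) (Hzero v)) /\
     same_space (optimal_domain (Top g) (Hzero v)) (Hzero w)).
Proof.
intros w.
destruct Hg' as [G_an [M1 HM1]]. destruct Hg'inv as [G_neq0 [_ [M2 HM2]]].
destruct (weight_le_pow v Hv Hinc) as [c1 [m [c1_pos v_pow]]].
destruct (weight_le_Rpower v Hv Hdec) as [c2 [b [c2_pos [b_pos v_Rpower]]]].
(* The maximum with 1 makes the bounds positive, as the constants of the norm equivalences must
   be. *)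
assert (M1_pos : 0 < Rmax 1 M1) by (assert (K := Rmax_l 1 M1); lra).
assert (M2_pos : 0 < Rmax 1 M2) by (assert (K := Rmax_l 1 M2); lra).
assert (G_diff := proj1 (analytic_cdiff _) G_an).
assert (G_le : forall z, in_disc z -> Cmod (C_derive g z) <= Rmax 1 M1).
{ intros z Hz. apply Rle_trans with (1 := HM1 z Hz), Rmax_r. }
assert (Ginv_le : forall z, in_disc z -> Cmod (/ C_derive g z) <= Rmax 1 M2).
{ intros z Hz. apply Rle_trans with (1 := HM2 z Hz), Rmax_r. }
assert (Hzero_domains := optimal_domains_Hzero v g Hv _ _ _ _ _ m M1_pos M2_pos c1_pos c2_pos b_pos
  G_diff G_le G_neq0 Ginv_le v_pow v_Rpower).
split; [|split].
- intros _. exact (optimal_domains_Hinf v g Hv _ _ _ _ _ m M1_pos M2_pos c1_pos c2_pos b_pos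
    G_diff G_le G_neq0 Ginv_le v_pow v_Rpower).
- intros Hlim _. exact (Hzero_domains Hlim).
- intros Hlim _. destruct (Hzero_domains Hlim) as [[HVT _] [[HTw _] [HVw _]]].
  split; [|now split]. split.
  + intros f Hf. now apply HVw, Hinf_sub_Hzero.
  (* The separating series lies in [Hzero w], which has just been identified with the optimal
     domain. *)
  + destruct (Hzero_not_Hinf v c1 m Hv c1_pos v_pow) as [f [Hf Hn]].
    exists f. split; [now apply HVw|exact Hn].
Qed.
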